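(* For $n\in\mathbb{N}$, let $(Y_n,X_n)$ and $(Y,X)$ be bivariate random vectors, with $Y_n$ and $Y$ non-degenerate, and let $C_{Y_n,X_n}$ and $C_{Y,X}$ be copulas of $(Y_n,X_n)$ and $(Y,X)$, respectively. Assume that (i) $C_{Y_n,X_n}\xrightarrow{\partial_2} C_{Y,X}$, and (ii) $(F_{X_n}\circ F_{X_n}^{-1})(t)\to (F_X\circ F_X^{-1})(t)$ for Lebesgue-almost all $t\in(0,1)$. Then $C_{Y_n,Y_n'}\to C_{Y,Y'}$ uniformly on $\overline{\mathrm{Ran}(F_Y)}\times\overline{\mathrm{Ran}(F_Y)}$. If additionally (iii) $(F_{Y_n}\circ F_{Y_n}^{-1})(t)\to (F_Y\circ F_Y^{-1})(t)$ for Lebesgue-almost all $t\in(0,1)$, then $\xi(Y_n,X_n)\to\xi(Y,X)$.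
   Context: For a non-degenerate real random variable $Y$ and a random variable $X$, Chatterjee's rank correlation is $$\xi(Y,X) := \frac{\int_{\mathbb{R}} \mathrm{Var}(P(Y\ge y\mid X))\,\mathrm{d}P^{Y}(y)}{\int_{\mathbb{R}} \mathrm{Var}(\mathbf{1}_{\{Y\ge y\}})\,\mathrm{d}P^{Y}(y)}.$$ $F_Y$ is the distribution function of $Y$, $F_Y^{-1}(t)=\inf\{y: F_Y(y)\ge t\}$ its generalized inverse, $\mathrm{Ran}(F_Y)$ the range of $F_Y$ and $\overline{A}$ the closure of a set $A\subseteq[0,1]$. A bivariate copula is a distribution function on $[0,1]^2$ with uniform marginals; $C$ is a copula of $(Y,X)$ if $F_{(Y,X)}(y,x)=C(F_Y(y),F_X(x))$ for all $y,x\in\mathbb{R}$. For bivariate copulas $D_n,D$, write $D_n\xrightarrow{\partial_2}D$ if $\int_0^1|\partial_2D_n(v,t)-\partial_2D(v,t)|\,\mathrm{d}t\to 0$ for all $v\in[0,1]$, where $\partial_2$ is the partial derivative with respect to the second component (which exists for Lebesgue-almost all $t$). $Y'$ denotes a conditionally independent copy of $Y$ relative to $X$: the conditional distribution of $Y'$ given $X=x$ equals that of $Y$ given $X=x$ for $P^X$-almost all $x$, and $Y,Y'$ are conditionally independent given $X$; similarly $Y_n'$ relative to $X_n$. The copula $C_{Y,Y'}$ of $(Y,Y')$ is the one given by the conditional independence product $$C_{Y,Y'}(u,u')=\int_0^1 \partial_2^{F_X}C_{Y,X}(u,t)\,\partial_2^{F_X}C_{Y,X}(u',t)\,\mathrm{d}t,\qquad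 u,u'\in[0,1],$$ and $C_{Y_n,Y_n'}$ is defined in the same way from $C_{Y_n,X_n}$ and $F_{X_n}$. Here, for a distribution function $G$ with left-continuous version $G^-$, and $a(t):=G^-(G^{-1}(t))$, $b(t):=G(G^{-1}(t))$, the generalized partial derivative is $\partial_2^{G}C(u,t)=\frac{C(u,b(t))-C(u,a(t))}{b(t)-a(t)}$ if $a(t)<b(t)$, and $\partial_2^{G}C(u,t)=\partial_2C(u,t)$ if $a(t)=b(t)=t$ (defined for Lebesgue-almost all $t\in(0,1)$). *)

(* Defs.v *)
From HB Require Import structures.
From mathcomp Require Import all_boot all_order all_algebra.
From mathcomp Require Import all_classical all_reals all_analysis.
From mathcomp Require Import measurable_realfun.
Import Order.TTheory GRing.Theory Num.Theory.
Import numFieldNormedType.Exports.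

Set Implicit Arguments.
Unset Strict Implicit.
Unset Printing Implicit Defensive.

Local Open Scope classical_set_scope.
Local Open Scope ring_scope.

Section distribution_functions.
Context {R : realType}.

Definition cdfR d (T : measurableType d) (P : probability T R)
  (X : {RV P >-> R}) (x : R) : R := fine (cdf X x).

Definition joint_cdfR d (T : measurableType d) (P : probability T R)
    (Y X : {RV P >-> R}) (y x : R) : R :=
  fine (P [set w | Y w <= y /\ X w <= x]).

Definition nondegenerate_rv d (T : measurableType d) (P : probability T R)
    (Y : {RV P >-> R}) : Prop :=
  ~ exists c : R, {ae P, forall w, Y w = c}.

(* Only meaningful for 0 < t < 1: otherwise the infimum may be over an empty or
   unbounded set, where [inf] takes the value 0. *)
Definition ginv (G : R -> R) (t : R) : R := inf [set y | t <= G y].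

Definition left_version (G : R -> R) (x : R) : R := lim (G y @[y --> x^'-]).

End distribution_functions.

Section copulas.
Context {R : realType}.
Notation mu := (@lebesgue_measure R).

(* Copulas are represented by total functions of which only the values on
   [0, 1]^2 matter. *)
Definition is_copula (C : R -> R -> R) : Prop :=
  exists m : probability (R * R)%type R,
    [/\ forall A : set R, measurable A ->
          m (A `*` setT) = uniform_prob (@ltr01 R) A,
        forall A : set R, measurable A ->
          m (setT `*` A) = uniform_prob (@ltr01 R) A &
        forall u v, u \in `[0, 1] -> v \in `[0, 1] ->
          C u v = fine (m (`]-oo, u] `*` `]-oo, v]))].

Definition is_copula_of d (T : measurableType d) (P : probability T R)
    (Y X : {RV P >-> R}) (C : R -> R -> R) : Prop :=
  is_copula C /\
  forall y x, joint_cdfR Y X y x = C (cdfR Y y) (cdfR X x).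

(* For a copula C and v in [0, 1], C v is differentiable at almost every t in
   (0, 1); [derive1] takes an irrelevant value at the other points. *)
Definition partial2 (C : R -> R -> R) (v t : R) : R := derive1 (C v) t.

Definition cvg_partial2 (Dn : nat -> R -> R -> R) (D : R -> R -> R) : Prop :=
  forall v, v \in `[0, 1] ->
    (\int[mu]_(t in `[0%R, 1%R]) `|partial2 (Dn n) v t - partial2 D v t|%:E)%E
      @[n --> \oo] --> 0%E.

(* For a distribution function G and 0 < t < 1, a <= t <= b always holds, so the
   second branch is the case a = b = t. *)
Definition gen_partial2 (G : R -> R) (C : R -> R -> R) (u t : R) : R :=
  let a := left_version G (ginv G t) in
  let b := G (ginv G t) in
  if a < b then (C u b - C u a) / (b - a) else partial2 C u t.

(* The copula of (Y, Y') with Y' a conditionally independent copy of Y relative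
   to X, computed from a copula C of (Y, X) and G = F_X. *)
Definition ci_product (G : R -> R) (C : R -> R -> R) (u u' : R) : R :=
  \int[mu]_(t in `[0, 1]) (gen_partial2 G C u t * gen_partial2 G C u' t).

End copulas.

Section conditional_probability.
Context d (T : measurableType d) (R : realType) (P : probability T R).

Definition is_cond_prob (X : {RV P >-> R}) (A : set T) (g : T -> R) : Prop :=
  [/\ measurable_fun setT (g : g_sigma_algebra_preimageType X -> R),
      P.-integrable setT (EFin \o g) &
      forall B : set T, g_sigma_algebra_preimage X B ->
        (\int[P]_(w in B) (g w)%:E)%E = P (A `&` B)].

Lemma is_cond_prob_exists (X : {RV P >-> R}) (A : set T) :
  measurable A -> exists g, is_cond_prob X A g.
Proof.
move=> mA.
pose nu0 : {charge set T -> \bar R} := crestr (charge_of_finite_measure P) mA.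
have mX : measurable_fun setT X by exact: measurable_funP.
have mXpre (B : set R) : measurable B -> measurable (X @^-1` B).
  by move=> mB; rewrite -[_ @^-1` _]setTI; exact: mX.
pose nu_ : {charge set R -> \bar R} := pushforward nu0 X.
pose nu := nu_ mX.
have nuP : nu `<< distribution P X.
  apply/null_content_dominatesP => B mB PB0.
  rewrite /nu /= /pushforward /nu0 /= /crestr.
  apply: (@subset_measure0 _ _ _ P _ (X @^-1` B)) => //.
  - by apply: measurableI => //; exact: mXpre.
  - exact: mXpre.
pose f : R -> \bar R := Radon_Nikodym nu (distribution P X).
have ffin x : f x \is a fin_num by exact: Radon_Nikodym_fin_num.
have fint : (distribution P X).-integrable setT f.
  exact: Radon_Nikodym_integrable.
have mf : measurable_fun setT f by exact: measurable_int fint.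
have mg : measurable_fun setT (fine \o f) by apply: measurableT_comp.
have fE : EFin \o (fine \o f \o X) = f \o X.
  by apply/funext => w /=; rewrite fineK.
have fXint : P.-integrable setT (f \o X).
  apply/integrableP; split; first exact: measurableT_comp.
  have /integrableP[_] := fint.
  rewrite ge0_integral_distribution //.
  by apply: measurableT_comp => //.
exists (fine \o f \o X); split.
- move=> _ B mB; rewrite setTI.
  exists ((fine \o f) @^-1` B); last by rewrite setTI.
  by rewrite -[_ @^-1` _]setTI; exact: mg.
- by rewrite fE.
- move=> B [B' mB' <-]; rewrite setTI.
  under eq_integral do rewrite /= fineK //.
  rewrite -(@integral_pushforward _ _ _ _ _ X _ P B' f) //.
  + rewrite -[LHS](Radon_Nikodym_integral nuP mB').
    by rewrite /nu /= /pushforward /nu0 /= /crestr setIC.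
  + by apply: (integrableS measurableT) fXint => //; exact: mXpre.
Qed.

(* A version of P(A | X), unique up to P-null sets. *)
Definition cond_prob (X : {RV P >-> R}) (A : set T) : T -> R :=
  get (is_cond_prob X A).

End conditional_probability.

Section rank_correlation.
Context d (T : measurableType d) (R : realType) (P : probability T R).
Local Open Scope ereal_scope.

Definition xi (Y X : {RV P >-> R}) : R :=
  (fine (\int[distribution P Y]_y 'V_P[cond_prob X [set w | (y <= Y w)%R]]) /
   fine (\int[distribution P Y]_y 'V_P[\1_[set w | (y <= Y w)%R]]))%R.

End rank_correlation.

(* Main.v *)
(* Let U be uniform on [0, 1] and G = F_X. For fixed u, the generalized partial
   derivative of C(u, .) with respect to G is the conditional expectation of
   the ordinary derivative given the quantile transform G^-1(U); this conditioning
   is an L1-contraction, which transfers the convergence (i) from C_n to the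
   generalized derivatives taken with respect to the same F_{X_n}. To pass from
   F_{X_n} to F_X for the fixed copula C, note that convergence of b_n = G_n(G_n^-1)
   forces that of the left limits a_n = G_n^-(G_n^-1); the difference quotients then
   converge almost everywhere, by differentiability of C(u, .) at t where
   a = b = t. Since everything is 1-Lipschitz in u in L1, the convergence of the
   conditional independence products is uniform on the whole square.

   For xi, P(Y >= y | X) is one minus the generalized partial derivative at
   u = F_Y^-(y), so its variance is ci_product(u, u) - u^2; the law of Y being that
   of F_Y^-1(U), both integrals become integrals over t of functions of the left
   limit of F_Y at F_Y^-1(t), which converges by (iii). The limiting denominator
   vanishes only if that left limit is 0 almost everywhere, i.e. if Y is
   constant. *)

Require Import Defs.
From HB Require Import structures.
From mathcomp Require Import all_boot all_order all_algebra.
From mathcomp Require Import all_classical all_reals all_analysis.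
From mathcomp Require Import measurable_realfun.
From mathcomp Require Import ring lra.
Import Order.TTheory GRing.Theory Num.Theory.
Import numFieldNormedType.Exports.
Local Open Scope classical_set_scope.
Local Open Scope ring_scope.

Set Implicit Arguments.
Unset Strict Implicit.
Unset Printing Implicit Defensive.

(** Two obstacles shape the proof. First, [partial2] and [gen_partial2] take irrelevant values where
    the derivative does not exist, so their measurability is not at hand. Each is tied to a
    measurable representative with values in [0, 1] that equals it almost everywhere, and integrals
    are computed with the representative. Second, the same conditional expectation is needed along
    two variables: along the quantile transform, where it is the generalized derivative, and along X
    itself, where it yields P(Y >= y | X). It is therefore built as a function [phi] of the value of
    the conditioning variable. Lebesgue measure on [0, 1] is made a probability on the line, so that
    quantile transforms are ordinary random variables. Uniformity over the whole square matters for
    xi: the products for C_n are evaluated at left limits of F_{Y_n}, which move with n and may lie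
    outside the closed range of F_Y. Left limits appear because the complement of Y >= y is Y <
    y. *)

(** * Integrals of functions that agree almost everywhere with a measurable one *)

Section ae_integral.
Context d (T : measurableType d) (R : realType) (mu : {measure set T -> \bar R}).
Local Open Scope ereal_scope.

Lemma le_integral_nonmeasurable (f g : T -> \bar R) :
  (forall x, 0 <= f x) -> (forall x, f x <= g x) ->
  \int[mu]_x f x <= \int[mu]_x g x.
Proof.
move=> f0 fg; rewrite !ge0_integralTE//; last first.
  by move=> x; exact: le_trans (f0 x) (fg x).
apply: le_ereal_sup => _ [h hf <-]; exists h => // x.
exact: le_trans (hf x) (fg x).
Qed.

(** The integral of a nonnegative function is a supremum over simple functions below it, hence
    monotone without measurability. Overwriting [g] on the null set by 0 and by +oo gives two
    measurable functions that enclose [f] and have the integral of [g]. *)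
Lemma ge0_ae_eq_integral_nonmeasurable (f g : T -> \bar R) :
  (forall x, 0 <= f x) -> (forall x, 0 <= g x) -> measurable_fun setT g ->
  {ae mu, forall x, f x = g x} -> \int[mu]_x f x = \int[mu]_x g x.
Proof.
move=> f0 g0 mg [N [mN N0 fgN]].
have fg x : ~ N x -> f x = g x.
  by move=> Nx; apply: contrapT => fgx; apply: Nx; exact: fgN.
have mNb : measurable_fun setT (fun x => x \in N).
  apply: (measurable_fun_bool true); rewrite setTI.
  by rewrite (_ : _ @^-1` _ = N)//; apply/seteqP; split=> x /=; [exact: set_mem|exact: mem_set].
pose h b x := if x \in N then b else g x.
have mh b : measurable_fun setT (h b) by apply: measurable_fun_ifT.
have hg b : 0 <= b -> \int[mu]_x h b x = \int[mu]_x g x.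
  move=> b0; apply: ge0_ae_eq_integral => //.
    by move=> x _; rewrite /h; case: ifP.
  exists N; split => // x /=; apply: contra_notP => Nx _.
  by rewrite /h memNset.
apply/eqP; rewrite eq_le; apply/andP; split.
- rewrite -(hg +oo)//; apply: le_integral_nonmeasurable => // x.
  rewrite /h; case: ifPn => [_|]; first by rewrite leey.
  by rewrite notin_setE => /fg ->.
- rewrite -(hg 0)//; apply: le_integral_nonmeasurable => x.
    by rewrite /h; case: ifP.
  by rewrite /h; case: ifPn => //; rewrite notin_setE => /fg ->.
Qed.

Lemma ae_eq_integral_nonmeasurable (D : set T) (f g : T -> \bar R) :
  measurable D -> measurable_fun D g -> ae_eq mu D f g ->
  \int[mu]_(x in D) f x = \int[mu]_(x in D) g x.
Proof.
move=> mD mg fg; rewrite integral_mkcond [RHS]integral_mkcond.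
have mgD : measurable_fun setT (g \_ D) by apply/(measurable_restrictT _ _).1.
have fgD : {ae mu, forall x, (f \_ D) x = (g \_ D) x}.
  by apply: filterS fg => x; rewrite !patchE; case: ifPn => // /set_mem /[swap] /[apply].
rewrite integralE [RHS]integralE; congr (_ - _).
- apply: ge0_ae_eq_integral_nonmeasurable => //; first exact: measurable_funepos.
  by apply: filterS fgD => x; rewrite !funeposE => ->.
- apply: ge0_ae_eq_integral_nonmeasurable => //; first exact: measurable_funeneg.
  by apply: filterS fgD => x; rewrite !funenegE => ->.
Qed.

End ae_integral.

(** * Bounded functions under a probability, and the L1 contraction *)

Section finite_integral.
Context d (T : measurableType d) (R : realType) (P : probability T R).

Lemma bounded_integrable (M : R) (D : set T) (f : T -> R) : measurable D ->
  measurable_fun setT f -> (forall x, `|f x| <= M) -> P.-integrable D (EFin \o f).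
Proof.
move=> mD mf fM; apply: (@integrableS _ _ _ _ setT) => //.
apply: (@le_integrable _ _ _ _ _ measurableT _ (EFin \o cst M)).
- exact/measurable_EFinP.
- move=> x _ /=; rewrite lee_fin (le_trans (fM x))//; exact: ler_norm.
- exact: finite_measure_integrable_cst.
Qed.

Lemma bounded01_integrable (f : T -> R) : measurable_fun setT f ->
  (forall x, 0 <= f x <= 1) -> P.-integrable setT (EFin \o f).
Proof.
move=> mf f01; apply: (@bounded_integrable 1) => // x.
by have /andP[f0 f1] := f01 x; rewrite ger0_norm.
Qed.

Lemma cvg_Rintegral_bounded (M : R) (f_ : nat -> T -> R) (f : T -> R) :
  (forall n, measurable_fun setT (f_ n)) -> measurable_fun setT f ->
  (forall n x, `|f_ n x| <= M) ->
  {ae P, forall x, f_ n x @[n --> \oo] --> f x} ->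
  (\int[P]_x `|f_ n x - f x| @[n --> \oo] --> (0 : R)) /\
  (\int[P]_x f_ n x @[n --> \oo] --> \int[P]_x f x).
Proof.
move=> mf_ mf f_M cf.
have c' : {ae P, forall x, setT x -> (EFin \o f_ n) x @[n --> \oo] --> (EFin \o f) x}.
  by apply: filterS cf => x c _; apply: cvg_EFin => //; exact: nearW.
have [] := @dominated_convergence _ _ _ P _ measurableT (fun n => EFin \o f_ n)
  (EFin \o f) (EFin \o cst M) _ _ c' _ _.
- by move=> n; exact/measurable_EFinP.
- exact/measurable_EFinP.
- exact: finite_measure_integrable_cst.
- by apply: aeW => x n _; rewrite /= lee_fin.
move=> fi /fine_cvgP[_ c0] c1; split; first exact: c0.
by apply: fine_cvg; rewrite fineK//; exact: integrable_fin_num.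
Qed.

(* The sign of [f] is measurable for the sub-sigma-algebra on which [f] is the
   conditional expectation of [g]. *)
Lemma le_norm1_cond_exp (f g : T -> R) :
  P.-integrable setT (EFin \o f) -> P.-integrable setT (EFin \o g) ->
  let A := [set x | 0 <= f x] in
  \int[P]_(x in A) f x = \int[P]_(x in A) g x ->
  \int[P]_(x in ~` A) f x = \int[P]_(x in ~` A) g x ->
  \int[P]_x `|f x| <= \int[P]_x `|g x|.
Proof.
move=> fi gi A fA fcA.
have mf : measurable_fun setT f by apply/measurable_EFinP; exact: measurable_int fi.
have mA : measurable A.
  rewrite (_ : A = f @^-1` `[0, +oo[); last first.
    by apply/seteqP; split => x /=; rewrite in_itv /= andbT.
  by rewrite -[X in measurable X]setTI; exact: mf.
have mcA : measurable (~` A) by exact: measurableC.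
have iS B (h : T -> R) : measurable B -> P.-integrable setT (EFin \o h) ->
    P.-integrable B (EFin \o h).
  by move=> mB; exact: integrableS.
have split_int h : P.-integrable setT (EFin \o h) ->
    \int[P]_x `|h x| = \int[P]_(x in A) `|h x| + \int[P]_(x in ~` A) `|h x|.
  move=> hi; rewrite -Rintegral_setU//; first by rewrite setUv.
    by rewrite setUv; exact: integrable_norm hi.
  by apply/disj_setPS => x [].
rewrite split_int// [leRHS]split_int// lerD//.
- rewrite (@eq_Rintegral _ _ _ _ _ f); last by move=> x /set_mem; exact: ger0_norm.
  rewrite fA le_Rintegral//; first exact: iS.
    exact/iS/integrable_norm.
  by move=> x _; exact: ler_norm.
- rewrite (@eq_Rintegral _ _ _ _ _ (fun x => -1 * f x)); last first.
    move=> x /set_mem /= /negP; rewrite -ltNge => /ltW /ler0_norm ->.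
    by rewrite mulN1r.
  rewrite RintegralZl//; last exact: iS.
  rewrite fcA -RintegralZl//; last exact: iS.
  rewrite le_Rintegral//.
  + apply: iS => //; rewrite (_ : _ \o _ = (fun x => (-1)%:E * (g x)%:E)%E).
      exact: integrableZl.
    by apply/funext.
  + exact/iS/integrable_norm.
  + by move=> x _; rewrite mulN1r -normrN ler_norm.
Qed.

Lemma Rintegral_norm_eq0 (f : T -> R) : P.-integrable setT (EFin \o f) ->
  \int[P]_x `|f x| <= 0 -> {ae P, forall x, f x = 0}.
Proof.
move=> fi f0.
have : (\int[P]_x `|(f x)%:E| = 0)%E.
  have := integrable_fin_num measurableT (integrable_norm fi).
  have : (0 <= \int[P]_x `|(f x)%:E|)%E by exact: integral_ge0.
  move: f0; rewrite /Rintegral /=; case: (\int[P]_x _)%E => [r| |]//=.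
  by move=> r0; rewrite lee_fin => r1 _; congr EFin; apply/eqP; rewrite eq_le r0.
move/(ae_eq_integral_abs _ measurableT (measurable_int _ fi)).
by apply: filterS => x /(_ Logic.I) [].
Qed.

Lemma ae_eq_Rintegral (D : set T) (f g : T -> R) :
  measurable D -> measurable_fun setT g -> {ae P, forall x, f x = g x} ->
  \int[P]_(x in D) f x = \int[P]_(x in D) g x.
Proof.
move=> mD mg fg; congr fine; apply: ae_eq_integral_nonmeasurable => //.
  by apply/measurable_EFinP; exact: measurable_funTS.
by apply: filterS fg => x -> .
Qed.

Lemma ae_eq_set_Rintegral (A B : set T) (f : T -> R) :
  measurable A -> measurable B -> measurable_fun setT f ->
  {ae P, forall x, A x <-> B x} ->
  \int[P]_(x in A) f x = \int[P]_(x in B) f x.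
Proof.
move=> mA mB mf AB; rewrite Rintegral_mkcond [RHS]Rintegral_mkcond.
apply: ae_eq_Rintegral => //.
  by apply/(measurable_restrictT _ _).1 => //; exact: measurable_funTS.
apply: filterS AB => x AB; rewrite !patchE; congr (if _ then _ else _).
by apply/idP/idP => /set_mem /AB /mem_set.
Qed.

End finite_integral.

Arguments bounded01_integrable {d T R} P {f}.

(* [uniform_prob] is a measure on [measurableTypeR R], whose display differs
   from that of the canonical measurable structure of [R]. *)
Definition borel_id (R : realType) : measurableTypeR R -> R := idfun.

Lemma measurable_borel_id (R : realType) : measurable_fun setT (@borel_id R).
Proof. by move=> _ A mA; rewrite setTI. Qed.

HB.instance Definition _ (R : realType) :=
  isMeasurableFun.Build _ _ _ _ (@borel_id R) (@measurable_borel_id R).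

Definition unif01 (R : realType) : probability R R :=
  distribution (uniform_prob (@ltr01 R)) (@borel_id R).

(** * The uniform law on [0, 1] as a probability on the line *)

Section unif01_theory.
Context {R : realType}.
Notation mu := (@lebesgue_measure R).
Notation lam := (unif01 R).

Lemma unif01E (A : set R) : lam A = uniform_prob (@ltr01 R) A.
Proof. by []. Qed.

Lemma ge0_integral_unif01 (f : R -> \bar R) : measurable_fun setT f ->
  (forall x, 0 <= f x)%E ->
  (\int[lam]_x f x = \int[mu]_(x in `[0%R, 1%R]) f x)%E.
Proof.
move=> mf f0; rewrite ge0_integral_pushforward//.
by rewrite integral_uniform// subr0 invr1 mul1e.
Qed.

Lemma integral_unif01 (f : R -> \bar R) : measurable_fun setT f ->
  (\int[lam]_x f x = \int[mu]_(x in `[0%R, 1%R]) f x)%E.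
Proof.
move=> mf; rewrite integralE [RHS]integralE !ge0_integral_unif01//.
- exact: measurable_funeneg.
- exact: measurable_funepos.
Qed.

Lemma unif01_mu (A : set R) : measurable A -> lam A = mu (A `&` `[0, 1]).
Proof.
move=> mA; rewrite -[LHS]mul1e -integral_cst// integral_mkcond.
rewrite integral_unif01.
  by rewrite -integral_mkcondr setIC integral_cst ?mul1e//; exact: measurableI.
by apply/(measurable_restrictT _ _).1.
Qed.

Lemma unif01_itv (a b : R) (x y : bool) : 0 <= a -> a <= b -> b <= 1 ->
  lam [set` Interval (BSide x a) (BSide y b)] = (b - a)%:E.
Proof.
move=> a0 ab b1; rewrite unif01_mu// setIidl; last first.
  move=> z /=; rewrite !itv_boundlr /= !bnd_simp => /andP[az zb].
  apply/andP; split.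
  - by case: x az; rewrite bnd_simp => az; rewrite (le_trans a0)// ltW.
  - by case: y zb; rewrite bnd_simp => zb; rewrite (le_trans _ b1)// ltW.
rewrite lebesgue_measure_itv /= lte_fin.
by move: ab; rewrite le_eqVlt => /orP[/eqP->|->//]; rewrite ltxx subrr.
Qed.

Lemma ae_unif01_in : {ae lam, forall t, t \in `]0, 1[}.
Proof.
exists (~` `]0, 1[); split => //; first exact: measurableC.
rewrite probability_setC//= unif01_itv//.
by rewrite subr0 subee.
Qed.

Lemma ae_lebesgue_unif01 (Q : R -> Prop) :
  {ae mu, forall t, t \in `]0, 1[ -> Q t} -> {ae lam, forall t, Q t}.
Proof.
move=> muQ; have lamQ : {ae lam, forall t, t \in `]0, 1[ -> Q t}.
  case: muQ => N [mN N0 NQ]; exists N; split => //.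
  have /null_content_dominatesP := dominates_uniform_prob (@ltr01 R).
  exact.
by apply: filterS2 ae_unif01_in lamQ => t t01; exact.
Qed.

Lemma Rintegral_unif01 (A : set R) (f : R -> R) : measurable A ->
  measurable_fun setT f ->
  \int[lam]_(t in A) f t = \int[mu]_(t in A) (f \_ `[0, 1]) t.
Proof.
move=> mA mf; rewrite -Rintegral_mkcondr /Rintegral; congr fine.
rewrite integral_mkcond integral_unif01; last first.
  apply/(measurable_restrictT _ _).1 => //.
  by apply/measurable_EFinP; exact: measurable_funTS.
by rewrite -integral_mkcondr setIC.
Qed.

(** Cutting [f] off outside [0, 1] turns [F] into an indefinite Lebesgue integral over the line, to
    which Lebesgue differentiation applies; on ]0, 1[ the cut-off changes nothing. *)
Lemma unif01_FTC (f : R -> R) : lam.-integrable setT (EFin \o f) ->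
  let F s := \int[lam]_(t in `]-oo, s]) f t in
  {ae lam, forall t, derivable F t 1 /\ derive1 F t = f t}.
Proof.
move=> fi F.
have mf : measurable_fun setT f by apply/measurable_EFinP; exact: measurable_int fi.
have muf : mu.-integrable `[0, 1] (EFin \o f).
  apply/integrableP; split; first by apply/measurable_EFinP; exact: measurable_funTS.
  have /integrableP[_] := fi; rewrite ge0_integral_unif01//.
  by apply: measurableT_comp => //; exact/measurable_EFinP.
have gi : mu.-integrable setT (EFin \o (f \_ `[0, 1])).
  rewrite -restrict_EFin; by apply: (integrable_mkcond _ _).1 muf.
have FE : (fun s => \int[mu]_(t in `]-oo, s]) (f \_ `[0, 1]) t) = F.
  by apply/funext => s; rewrite /F Rintegral_unif01.
apply: ae_lebesgue_unif01.
have : {ae mu, forall x, derivable F x 1 /\ derive1 F x = (f \_ `[0, 1]) x}.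
  rewrite -FE; apply: FTC1Ny; first by move=> y; exact: integrableS gi.
  exact: integrable_locally.
apply: filterS; first exact: (ae_filter_ringOfSetsType mu).
move=> x [dF ->] /[!in_itv]/= /andP[/ltW x0 /ltW x1]; split => //.
by rewrite patchE mem_set//= in_itv /= x0.
Qed.

End unif01_theory.

(** * Conditional expectation as a function of the conditioning variable *)

Section conditional_expectation.
Context d (T : measurableType d) (R : realType) (P : probability T R).

(** [phi] is the Radon-Nikodym derivative, with respect to the law of [X], of the image under [X] of
    the charge with density [h]. Absolute continuity holds because [h] integrates to 0 over a null
    preimage. *)
Lemma cond_exp_exists (X : {RV P >-> R}) (h : T -> R) :
  P.-integrable setT (EFin \o h) ->
  exists phi : R -> R, [/\ measurable_fun setT phi,
    P.-integrable setT (EFin \o (phi \o X)) &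
    forall B, measurable B ->
      \int[P]_(w in X @^-1` B) phi (X w) = \int[P]_(w in X @^-1` B) h w].
Proof.
move=> hi; pose nu0 := induced_charge hi.
have mX : measurable_fun setT X by exact: measurable_funP.
have mXpre (B : set R) : measurable B -> measurable (X @^-1` B).
  by move=> mB; rewrite -[_ @^-1` _]setTI; exact: mX.
pose nu_ : {charge set R -> \bar R} := pushforward nu0 X.
pose nu := nu_ mX.
have mh : measurable_fun setT (EFin \o h) by exact: measurable_int hi.
have nuP : nu `<< distribution P X.
  apply/null_content_dominatesP => B mB PB0.
  rewrite /nu /= /pushforward /nu0 /= /induced_charge.
  apply: null_set_integral => //; first exact: mXpre.
  exact: measurable_funTS.
pose f : R -> \bar R := Radon_Nikodym nu (distribution P X).
have ffin x : f x \is a fin_num by exact: Radon_Nikodym_fin_num.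
have fint : (distribution P X).-integrable setT f.
  exact: Radon_Nikodym_integrable.
have mf : measurable_fun setT f by exact: measurable_int fint.
have fE : EFin \o (fine \o f \o X) = f \o X.
  by apply/funext => w /=; rewrite fineK.
have fXint : P.-integrable setT (f \o X).
  apply/integrableP; split; first exact: measurableT_comp.
  have /integrableP[_] := fint.
  rewrite ge0_integral_distribution //.
  by apply: measurableT_comp => //.
exists (fine \o f); split.
- by apply: measurableT_comp.
- by rewrite [X in _.-integrable _ X]fE.
- move=> B mB; rewrite /Rintegral; congr fine.
  under eq_integral do rewrite /= fineK //.
  rewrite -(@integral_pushforward _ _ _ _ _ X _ P B f) //.
  + by rewrite -[LHS](Radon_Nikodym_integral nuP mB).
  + by apply: (integrableS measurableT) fXint => //; exact: mXpre.
Qed.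

End conditional_expectation.

(** * Slopes near a point of differentiability *)

Section derivative.
Context {R : realType}.
Implicit Types f : R -> R.

Lemma derivable_near (f : R -> R) (t e : R) : derivable f t 1 -> 0 < e ->
  exists2 r, 0 < r & forall s, `|s - t| < r ->
    `|f s - f t - derive1 f t * (s - t)| <= e * `|s - t|.
Proof.
move=> df e0; have : h^-1 *: (f (h + t) - f t) @[h --> 0^'] --> derive1 f t.
  rewrite derive1E; have := df; rewrite /derivable /derive /=.
  rewrite (_ : (fun h => h^-1 *: (f (h%:A + t) - f t)) =
               (fun h => h^-1 *: (f (h + t) - f t)))//.
  by apply/funext => h; rewrite [h%:A]mulr1.
move=> /cvgrPdist_le /(_ e e0)[r /= r0 fr].
exists r => // s str; have [->|st] := eqVneq s t.
  by rewrite !subrr mulr0 subr0 normr0 mulr0.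
have := fr (s - t); rewrite /= sub0r normrN => /(_ str); rewrite subr_eq0 => /(_ st).
rewrite subrK distrC => Hle; have st0 : s - t != 0 by rewrite subr_eq0.
have -> : f s - f t - derive1 f t * (s - t) =
    ((s - t)^-1 *: (f s - f t) - derive1 f t) * (s - t).
  by rewrite /GRing.scale /=; field.
by rewrite normrM ler_wpM2r.
Qed.

(** Straddle lemma: since a <= t <= b, the first-order errors e (b - t) and e (t - a) add up to
    exactly e (b - a). Differentiability at [t] alone therefore controls slopes between two points
    that both move. *)
Lemma derivable_slope_near (f : R -> R) (t e : R) : derivable f t 1 -> 0 < e ->
  exists2 r, 0 < r & forall a b, `|t - a| < r -> `|t - b| < r ->
    a <= t <= b -> a < b ->
    `|derive1 f t - (f b - f a) / (b - a)| <= e.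
Proof.
move=> df e0; have [r r0 fr] := derivable_near df e0; exists r => // a b.
rewrite ![`|t - _|]distrC => da db /andP[an bn] abn.
have := fr _ da; have := fr _ db.
rewrite (ger0_norm (_ : 0 <= b - t)) ?subr_ge0//.
rewrite (ler0_norm (_ : a - t <= 0)) ?subr_le0//.
rewrite !ler_norml => /andP[b1 b2] /andP[a1 a2].
have ban : 0 < b - a by rewrite subr_gt0.
have -> : derive1 f t - (f b - f a) / (b - a) =
    (derive1 f t * (b - a) - (f b - f a)) / (b - a).
  by field; rewrite gt_eqF.
rewrite ler_pdivlMr// ler_pdivrMr//; apply/andP; split; nra.
Qed.

Lemma cvg_left_slope (f : R -> R) (t : R) (a : nat -> R) : derivable f t 1 ->
  a @ \oo --> t -> (forall n, a n < t) ->
  (f t - f (a n)) / (t - a n) @[n --> \oo] --> derive1 f t.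
Proof.
move=> df at_ lt_at; apply/cvgrPdist_le => e e0.
have [r r0 fr] := derivable_slope_near df e0.
near=> n; apply: fr => //; first by near: n; move/cvgrPdist_lt : at_; exact.
- by rewrite subrr normr0.
- by rewrite ltW /=.
Unshelve. all: by end_near. Qed.

End derivative.

(** * Distribution functions, their left limits and quantiles *)

Section cdf_theory.
Context {R : realType}.
Implicit Types (G : R -> R) (s t x y : R).

Definition is_cdf G : Prop :=
  [/\ {homo G : x y / x <= y}, right_continuous G,
      G @ -oo --> (0 : R) & G @ +oo --> (1 : R)].

Lemma is_cdf01 G x : is_cdf G -> 0 <= G x <= 1.
Proof.
move=> [ndG _ G0 G1]; apply/andP; split.
- apply: (cvgr_to_le G0); near=> y; apply: ndG.
  by near: y; apply: nbhs_ninfty_le; rewrite num_real.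
- apply: (cvgr_to_ge G1); near=> y; apply: ndG.
  by near: y; apply: nbhs_pinfty_ge; rewrite num_real.
Unshelve. all: by end_near. Qed.

(** Galois connection between quantile and distribution function. The limits 0 and 1 make the set
    under the infimum bounded below and nonempty for 0 < t < 1; right continuity makes the infimum
    attained. *)
Lemma ginv_le G t x : is_cdf G -> 0 < t < 1 -> (ginv G t <= x) = (t <= G x).
Proof.
move=> [ndG rG G0 G1] /andP[t0 t1]; set S := [set y | t <= G y].
have S0 : S !=set0.
  have [y [_ yP]] := @cvgr_gt R _ _ _ G 1 G1 t t1.
  by exists (y + 1); apply: ltW; apply: yP; rewrite ltrDl.
have Slb : has_lbound S.
  have [y [_ yP]] := @cvgr_lt R _ _ _ G 0 G0 t t0.
  exists (y - 1) => z; rewrite /S /= leNgt => /negP tz; rewrite leNgt.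
  apply/negP => zy; apply: tz; apply: yP; rewrite (lt_trans zy)//.
  by rewrite gtrDl ltrN10.
have Sinf : has_inf S by [].
apply/idP/idP => [qx|tGx]; last exact: ge_inf.
apply: le_trans (ndG _ _ qx); rewrite leNgt; apply/negP => Gt.
have := @cvgr_lt R _ _ _ G _ (rG (ginv G t)) t Gt.
move=> [e /= e0 eP].
have [y Sy yl] := inf_adherent e0 Sinf.
have qy : ginv G t <= y by exact: ge_inf.
move: qy; rewrite le_eqVlt => /orP[/eqP qy|qy].
  by move: Gt; rewrite qy ltNge; move: Sy; rewrite /S /= => ->.
have : G y < t.
  apply: eP => //=; rewrite ltr0_norm ?subr_lt0// opprB ltrBlDl.
  exact: yl.
by rewrite ltNge; move: Sy; rewrite /S /= => ->.
Qed.

Lemma cvg_left_version G x : is_cdf G -> G y @[y --> x^'-] --> left_version G x.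
Proof.
move=> hG; apply: nondecreasing_at_left_is_cvgr; near=> z.
  by move=> y1 y2 _ _; have [ndG _ _ _] := hG; exact: ndG.
by exists 1 => _ [y _ <-]; have /andP[] := is_cdf01 y hG.
Unshelve. all: by end_near. Qed.

Lemma left_version_ge G x y : is_cdf G -> y < x -> G y <= left_version G x.
Proof.
move=> hG yx; apply: (cvgr_to_ge (@cvg_left_version G x hG)).
near=> z; have [ndG _ _ _] := hG; apply: ndG; apply: ltW.
by near: z; exact: nbhs_left_gt.
Unshelve. all: by end_near. Qed.

Lemma left_version_le G x : is_cdf G -> left_version G x <= G x.
Proof.
move=> hG; apply: (cvgr_to_le (@cvg_left_version G x hG)).
near=> z; have [ndG _ _ _] := hG; apply: ndG; apply: ltW.
by near: z; exact: nbhs_left_lt.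
Unshelve. all: by end_near. Qed.

Lemma left_version_gt G x s : is_cdf G -> s < left_version G x ->
  exists2 y, y < x & s < G y.
Proof.
move=> hG sx; near x^'- => y; exists y.
  by near: y; exact: nbhs_left_lt.
by near: y; exact: (@cvgr_gt R _ _ _ G _ (@cvg_left_version G x hG) s sx).
Unshelve. all: by end_near. Qed.

Lemma left_version01 G x : is_cdf G -> 0 <= left_version G x <= 1.
Proof.
move=> hG; have /andP[_ G1] := is_cdf01 x hG.
have /andP[G0 _] := is_cdf01 (x - 1) hG.
rewrite (le_trans (left_version_le x hG))// andbT.
by apply: le_trans G0 _; apply: left_version_ge => //; rewrite gtrDl ltrN10.
Qed.

Lemma left_version_homo G : is_cdf G -> {homo left_version G : x y / x <= y}.
Proof.
move=> hG x y; rewrite le_eqVlt => /orP[/eqP->//|xy].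
exact: le_trans (left_version_le x hG) (left_version_ge hG xy).
Qed.

Lemma le_cdf_ginv G t : is_cdf G -> 0 < t < 1 -> t <= G (ginv G t).
Proof. by move=> hG t01; rewrite -ginv_le. Qed.

Lemma left_version_ginv_le G t : is_cdf G -> 0 < t < 1 ->
  left_version G (ginv G t) <= t.
Proof.
move=> hG t01; rewrite leNgt; apply/negP => /(left_version_gt hG)[y yq ty].
by move: yq; rewrite ltNge ginv_le// (ltW ty).
Qed.

Lemma cdf_lt_ginv G t x : is_cdf G -> 0 < t < 1 -> x < ginv G t -> G x < t.
Proof. by move=> hG t01; rewrite !ltNge ginv_le. Qed.

(** All levels in ]a, b], the jump of [G] at the quantile of [t], share that quantile. The left end
    is excluded because the quantile of [a] may lie further left. *)
Lemma eq_ginv G s t : is_cdf G -> 0 < s < 1 -> 0 < t < 1 ->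
  left_version G (ginv G t) < s -> s <= G (ginv G t) -> ginv G s = ginv G t.
Proof.
move=> hG s01 t01 ls sG; apply/eqP; rewrite eq_le ginv_le// sG /=.
rewrite leNgt; apply/negP => qst.
have := left_version_ge hG qst; apply/negP; rewrite -ltNge.
exact: lt_le_trans ls (le_cdf_ginv hG s01).
Qed.

(** Some x left of the quantile of [t] already has G x > s, so the quantile of [s] is at most x. The
    strict inequality passes through [t] itself and thus holds even where [G] has no jump. *)
Lemma cdf_ginv_lt_left G s t : is_cdf G -> 0 < s < 1 -> 0 < t < 1 ->
  s < left_version G (ginv G t) ->
  G (ginv G s) <= left_version G (ginv G t) /\ G (ginv G s) < G (ginv G t).
Proof.
move=> hG s01 t01 /(left_version_gt hG)[x xq sx].
have qs : ginv G s <= x by rewrite ginv_le// ltW.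
split; first by apply: left_version_ge => //; exact: le_lt_trans qs xq.
apply: (@lt_le_trans _ _ t); last exact: le_cdf_ginv.
by apply: cdf_lt_ginv => //; exact: le_lt_trans qs xq.
Qed.

End cdf_theory.

Lemma ae_eq_measure d (T : measurableType d) (R : realType)
    (P : probability T R) (A B : set T) : measurable A -> measurable B ->
  {ae P, forall x, A x <-> B x} -> P A = P B.
Proof.
move=> mA mB AB; rewrite -[A]setIT -[B]setIT -!integral_indic//.
apply: ae_eq_integral => //; try exact/measurable_EFinP/measurable_indic.
apply: filterS AB => x AB _; congr (_%:E); rewrite !indicE; congr ((nat_of_bool _)%:R).
by apply/idP/idP => /set_mem /AB /mem_set.
Qed.

(** * The quantile transform and the convergence of left limits *)

Section quantile_transform.
Context {R : realType}.
Notation lam := (unif01 R).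
Implicit Types (G : R -> R) (s t x y : R).

Lemma ae_unif01_dense (Q : R -> Prop) x y : {ae lam, forall t, Q t} ->
  0 <= x -> x < y -> y <= 1 -> exists2 t, x < t < y & Q t.
Proof.
move=> [N [mN N0 NQ]] x0 xy y1; apply: contrapT => noQ.
have xyN : `]x, y[ `<=` N.
  move=> t txy; apply: NQ => /= Qt; apply: noQ; exists t => //.
have : (lam `]x, y[%classic <= lam N)%E by apply: le_measure; rewrite ?inE.
by rewrite N0 (unif01_itv _ _ x0 (ltW xy) y1) leNgt lte_fin subr_gt0 xy.
Qed.

(** Set to 0 off ]0, 1[, where [ginv] is meaningless, to obtain a globally measurable function and
    hence a random variable under [lam]. *)
Definition quant G t : R := if 0 < t < 1 then ginv G t else 0.

Lemma quantE G t : 0 < t < 1 -> quant G t = ginv G t.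
Proof. by rewrite /quant => ->. Qed.

Lemma measurable_quant G : is_cdf G -> measurable_fun setT (quant G).
Proof.
move=> hG; apply: measurable_fun_if => //=.
- by apply: measurable_and; exact: measurable_fun_ltr.
- rewrite setTI (_ : _ @^-1` _ = `]0, 1[%classic); last first.
    by apply/seteqP; split => t; rewrite /= in_itv.
  apply: (measurability _ (RGenOInfty.measurableE R)) => // _ [_ [x ->] <-].
  rewrite (_ : _ `&` _ = `]0, 1[%classic `&` `]G x, +oo[%classic); first exact: measurableI.
  apply/seteqP; split => t; rewrite /= !in_itv /= !andbT => -[t01 H];
    by split => //; move: H; rewrite !ltNge ginv_le.
Qed.

(* Lower bound: if the n-th left limit at t is below some s < a, then
   ginv (Gn n) s = ginv (Gn n) t, although Gn (ginv (Gn n)) has a smaller limit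
   at s than at t. Upper bound: for a < s < t, ginv G s = ginv G t, hence
   eventually t < Gn n (ginv (Gn n) s), ginv (Gn n) t = ginv (Gn n) s, and the
   n-th left limit at t is at most s. *)
Lemma cvg_left_version_ginv (Gn : nat -> R -> R) G (E : set R) :
  (forall n, is_cdf (Gn n)) -> is_cdf G ->
  (forall x y, 0 <= x -> x < y -> y <= 1 -> exists2 t, x < t < y & E t) ->
  (forall t, E t -> 0 < t < 1 ->
    Gn n (ginv (Gn n) t) @[n --> \oo] --> G (ginv G t)) ->
  forall t, E t -> 0 < t < 1 ->
    (left_version G (ginv G t) < t -> t < G (ginv G t)) ->
    left_version (Gn n) (ginv (Gn n) t) @[n --> \oo] --> left_version G (ginv G t).
Proof.
move=> hGn hG dE cE t Et t01 ht; have /andP[t0 t1] := t01.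
set a := left_version G (ginv G t).
have at_ : a <= t by exact: left_version_ginv_le.
have /andP[a0 a1] : 0 <= a <= 1 by exact: left_version01.
apply/cvgrPdist_lt => e e0.
have lo : \forall n \near \oo, a - e < left_version (Gn n) (ginv (Gn n) t).
  have [a_eq0|a_gt0] := leP a 0.
    near=> n; have /andP[+ _] := left_version01 (ginv (Gn n) t) (hGn n).
    by apply: lt_le_trans; rewrite subr_lt0 (le_lt_trans a_eq0).
  have [|||s /andP[ms sa] Es] := dE (Num.max 0 (a - e)) a.
  - by rewrite le_max lexx.
  - by rewrite gt_max a_gt0 gtrDl oppr_lt0.
  - by [].
  move: ms; rewrite gt_max => /andP[s0 aes].
  have s01 : 0 < s < 1 by rewrite s0 (lt_le_trans sa).
  have [_ Gst] := cdf_ginv_lt_left hG s01 t01 sa.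
  have cs := cE s Es s01; have ct := cE t Et t01.
  near=> n; rewrite ltNge; apply/negP => ae.
  have lts : left_version (Gn n) (ginv (Gn n) t) < s by exact: le_lt_trans ae aes.
  have sb : s <= Gn n (ginv (Gn n) t).
    by rewrite (le_trans (ltW sa))// (le_trans at_)// le_cdf_ginv.
  have qq := eq_ginv (hGn n) s01 t01 lts sb.
  pose m := (G (ginv G s) + G (ginv G t)) / 2.
  have : Gn n (ginv (Gn n) s) < m.
    near: n; apply: (@cvgr_lt R _ _ _ _ _ cs); rewrite /m; lra.
  have : m < Gn n (ginv (Gn n) t).
    near: n; apply: (@cvgr_gt R _ _ _ _ _ ct); rewrite /m; lra.
  by rewrite qq => h1 /(lt_trans h1); rewrite ltxx.
have hi : \forall n \near \oo, left_version (Gn n) (ginv (Gn n) t) < a + e.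
  move: at_; rewrite le_eqVlt => /orP[/eqP at_|at_].
    near=> n; apply: le_lt_trans (left_version_ginv_le (hGn n) t01) _.
    by rewrite -at_ ltrDl.
  have [|||s /andP[as_ sm] Es] := dE a (Num.min t (a + e)).
  - by [].
  - by rewrite lt_min at_ ltrDl.
  - by rewrite ge_min (ltW t1).
  move: sm; rewrite lt_min => /andP[st sae].
  have s01 : 0 < s < 1 by rewrite (le_lt_trans a0)//= (lt_trans st).
  have qs : ginv G s = ginv G t.
    by apply: eq_ginv => //; rewrite (le_trans (ltW st))// le_cdf_ginv.
  have cs := cE s Es s01.
  near=> n; apply: le_lt_trans sae.
  have -> : ginv (Gn n) t = ginv (Gn n) s; last exact: left_version_ginv_le.
  apply: eq_ginv => //.
    exact: le_lt_trans (left_version_ginv_le (hGn n) s01) st.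
  apply: ltW; near: n; apply: (@cvgr_gt R _ _ _ _ _ cs); rewrite qs; exact: ht.
near=> n; rewrite ltr_distlC; apply/andP; split; near: n => //.
Unshelve. all: by end_near. Qed.

(** The points to discard are the right ends t = b of jumps ]a, b] with a < b: if the n-th jump ends
    just below [t], the n-th left limit can tend to [t] instead of [a]. A rational r in ]a, t[ has
    the quantile of [t], so t = G (ginv G r), and such points are countably many. *)
Lemma ae_cvg_left_version_ginv (Gn : nat -> R -> R) G :
  (forall n, is_cdf (Gn n)) -> is_cdf G ->
  {ae lam, forall t, Gn n (ginv (Gn n) t) @[n --> \oo] --> G (ginv G t)} ->
  {ae lam, forall t,
    left_version (Gn n) (ginv (Gn n) t) @[n --> \oo] --> left_version G (ginv G t)}.
Proof.
move=> hGn hG cG.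
have cE : {ae lam, forall t, ~ range (fun r : rat => G (ginv G (ratr r))) t}.
  apply: ae_lebesgue_unif01; exists (range (fun r : rat => G (ginv G (ratr r)))).
  have cr : countable (range (fun r : rat => G (ginv G (ratr r)))).
    exact: sub_countable (card_image_le _ _) (countableP _).
  split; first exact: countable_measurable.
  - exact: countable_lebesgue_measure0.
  - by move=> t /= nt; apply: contrapT => rt; apply: nt.
have dG := ae_unif01_dense cG.
apply: filterS3 ae_unif01_in cG cE => t /[!in_itv]/= t01 ct nt.
apply: (@cvg_left_version_ginv _ _
  (fun t => Gn n (ginv (Gn n) t) @[n --> \oo] --> G (ginv G t))) => //.
- move=> at_; rewrite lt_neqAle le_cdf_ginv// andbT; apply/eqP => tG.
  have [r /andP[ar rt]] := rat_in_itvoo at_.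
  apply: nt; exists r => //; rewrite [RHS]tG; congr G.
  rewrite !bnd_simp in ar rt; have /andP[_ t1] := t01.
  have /andP[a0 _] := left_version01 (ginv G t) hG.
  apply: eq_ginv => //; first by rewrite (le_lt_trans a0 ar) (lt_trans rt).
  by rewrite (le_trans (ltW rt))// -tG.
Qed.

Lemma eq_finite_measureR (m1 m2 : {measure set R -> \bar R}) :
  (m1 setT < +oo)%E ->
  (forall x, m1 `]-oo, x]%classic = m2 `]-oo, x]%classic) ->
  forall A, measurable A -> m1 A = m2 A.
Proof.
move=> m1fin m12.
apply: (measure_unique (@ocitv R) (fun n => `](- n%:R), n%:R]%classic)) => //.
- exact: ocitvI.
- by move=> n; exists (- n%:R, n%:R).
- apply/seteqP; split => // x _; exists (Num.truncn `|x|).+1 => //=.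
  have := truncnS_gt `|x|; rewrite in_itv /= ltr_norml => /andP[-> /ltW ->] //.
- move=> _ [[a b] _ <-] /=.
  have [ab|ba] := ltP a b; last by rewrite set_itv_ge ?bnd_simp -?leNgt// !measure0.
  have m1f y : (m1 `]-oo, y]%classic < +oo)%E.
    by apply: le_lt_trans m1fin; apply: le_measure; rewrite ?inE.
  have E : `]a, b]%classic = `]-oo, b]%classic `\` `]-oo, a]%classic.
    apply/seteqP; split => x /=; rewrite !in_itv /=.
      by move=> /andP[ax ->]; split => //; apply/negP; rewrite -ltNge.
    by move=> [-> /negP]; rewrite -ltNge => ->.
  have sub : `]-oo, b]%classic `&` `]-oo, a]%classic = `]-oo, a]%classic :> set R.
    by apply: setIidr; apply: subset_itvl; rewrite bnd_simp ltW.
  have m2f : (m2 `]-oo, b]%classic < +oo)%E by rewrite -m12.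
  rewrite E measureD//; last exact: m1f.
  by rewrite measureD// sub; congr (_ - _)%E; exact: m12.
- move=> n; apply: le_lt_trans m1fin; apply: le_measure; rewrite ?inE//.
Qed.

Lemma quant_law G x : is_cdf G -> lam (quant G @^-1` `]-oo, x]) = (G x)%:E.
Proof.
move=> hG; have /andP[G0 G1] := is_cdf01 x hG.
have -> : lam (quant G @^-1` `]-oo, x]) = lam `]0, G x]%classic.
  apply: ae_eq_measure => //.
    by rewrite -[X in measurable X]setTI; exact: measurable_quant.
  apply: filterS ae_unif01_in => t /[!in_itv]/= t01.
  by rewrite /= !in_itv /= quantE// ginv_le//; have /andP[-> _] := t01.
by rewrite (unif01_itv _ _ (lexx 0) G0 G1) subr0.
Qed.

End quantile_transform.

(** * Conditioning on the quantile transform *)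

Section quantile_conditioning.
Context {R : realType}.
Notation lam := (unif01 R).
Implicit Types (G : R -> R) (s t x y : R).

Lemma ae_unif01_neq a : {ae lam, forall t, t != a}.
Proof.
apply: ae_lebesgue_unif01; exists [set a]; split => //.
- exact: lebesgue_measure_set1.
- by move=> t /= ta; apply: contrapT => /eqP ta'; apply: ta.
Qed.

Definition quantRV G (hG : is_cdf G) : {RV lam >-> R} :=
  mfun_Sub (mem_set (measurable_quant hG)).

Lemma cvg_cdf_left_seq G x : is_cdf G ->
  G (x - k.+1%:R^-1) @[k --> \oo] --> left_version G x.
Proof.
move=> hG; have /cvg_at_leftP := @cvg_left_version R G x hG; apply; split.
  by move=> n; rewrite gtrDl oppr_lt0 invr_gt0.
rewrite -[X in _ --> X]subr0; apply: cvgB; first exact: cvg_cst.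
exact: cvg_harmonic.
Qed.

(* [F] and [H] coincide on the range of [G]. Where [quant G] is constant on
   ]a, b], average [h] over it; elsewhere a = b = t, and differentiating [F] and
   [H] at [t] along the values G (x0 - 1/k), which increase to [t], gives
   phi (quant G t) = h t. *)
Lemma cond_exp_quant G (h phi : R -> R) (H := fun s => \int[lam]_(t in `]-oo, s]) h t) :
  is_cdf G -> lam.-integrable setT (EFin \o h) ->
  measurable_fun setT phi -> lam.-integrable setT (EFin \o (phi \o quant G)) ->
  (forall B, measurable B ->
    \int[lam]_(t in quant G @^-1` B) phi (quant G t) =
    \int[lam]_(t in quant G @^-1` B) h t) ->
  {ae lam, forall t, phi (quant G t) =
    let a := left_version G (ginv G t) in let b := G (ginv G t) in
    if a < b then (H b - H a) / (b - a) else h t}.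
Proof.
move=> hG hi mphi phii phiB.
have mh : measurable_fun setT h by apply/measurable_EFinP; exact: measurable_int hi.
have mq := measurable_quant hG.
have mpq : measurable_fun setT (phi \o quant G) by exact: measurableT_comp.
have mqB B : measurable B -> measurable (quant G @^-1` B).
  by move=> mB; rewrite -[X in measurable X]setTI; exact: mq.
pose F s := \int[lam]_(t in `]-oo, s]) (phi \o quant G) t.
have FH x : F (G x) = H (G x).
  have aeE : {ae lam, forall t, `]-oo, G x]%classic t <-> (quant G @^-1` `]-oo, x]) t}.
    apply: filterS ae_unif01_in => t /[!in_itv]/= t01.
    by rewrite /= !in_itv /= quantE// ginv_le.
  rewrite /F /H (ae_eq_set_Rintegral _ _ mpq aeE)//; last exact: mqB.
  rewrite (ae_eq_set_Rintegral _ _ mh aeE)//; last exact: mqB.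
  exact: phiB.
have dF := unif01_FTC phii; have dH := unif01_FTC hi.
apply: filterS3 ae_unif01_in dF dH => t /[!in_itv]/= t01 [dF F't] [dH H't].
rewrite quantE//; set x0 := ginv G t; set a := left_version G x0; set b := G x0.
have at_ : a <= t by exact: left_version_ginv_le.
have tb : t <= b by exact: le_cdf_ginv.
have [ab|ba] := ltP a b.
(* The level set of [quant G] at [x0] is ]a, b], possibly together with [a], when [G] does not reach
   [a] before [x0]; the point [a] is a null set. *)
- have aeE : {ae lam, forall s, `]a, b]%classic s <-> (quant G @^-1` [set x0]) s}.
    apply: filterS2 ae_unif01_in (ae_unif01_neq a) => s /[!in_itv]/= s01 sa.
    rewrite /= !in_itv /= quantE//; split=> [/andP[as_ sb]|sx0].
      exact: eq_ginv.
    rewrite /b -sx0 le_cdf_ginv// andbT lt_neqAle eq_sym sa /=.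
    by rewrite /a -sx0; exact: left_version_ginv_le.
  have /andP[b0 b1] := is_cdf01 x0 hG; have /andP[a0 a1] := left_version01 x0 hG.
  have lamE : lam (quant G @^-1` [set x0]) = (b - a)%:E.
    rewrite -(ae_eq_measure _ _ aeE)//; last exact: mqB.
    exact: (unif01_itv _ _ a0 (ltW ab) b1).
  have := phiB [set x0] (measurable_set1 x0).
  rewrite (@eq_Rintegral _ _ _ _ _ (fun=> phi x0)); last first.
    by move=> s /set_mem /= ->.
  rewrite Rintegral_cst; last exact: mqB.
  rewrite [fine _](congr1 fine lamE) /=.
  rewrite -(ae_eq_set_Rintegral _ _ mh aeE)//; last exact: mqB.
  have -> : \int[lam]_(s in `]a, b]) h s = H b - H a.
    rewrite /H (_ : `]-oo, b]%classic = `]-oo, a]%classic `|` `]a, b]%classic).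
      rewrite Rintegral_setU//.
      + by rewrite addrC addKr.
      + by apply: integrableS hi => //; exact: measurableU.
      + by apply/disj_setPS => s [/=]; rewrite !in_itv /= => sa /andP[/lt_geF]; rewrite sa.
    by rewrite -itv_bndbnd_setU// bnd_simp ltW.
  by move=> /(congr1 (fun z => z / (b - a))); rewrite mulfK// gt_eqF// subr_gt0.
- have bt : b = t by apply/eqP; rewrite eq_le tb (le_trans ba).
  have at' : a = t by apply/eqP; rewrite eq_le at_ -bt.
  pose u k := G (x0 - k.+1%:R^-1).
  have ut : u @ \oo --> t by rewrite -at'; exact: cvg_cdf_left_seq.
  have ult k : u k < t.
    by apply: cdf_lt_ginv => //; rewrite gtrDl oppr_lt0 invr_gt0.
  have := cvg_left_slope dH ut ult; rewrite H't => cH.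
  have := cvg_left_slope dF ut ult; rewrite F't => cF.
  rewrite quantE// -/x0 in cF; apply: (cvg_unique (@Rhausdorff R) cF) => //.
  (* Here t = b = G x0, so both ends of every slope lie in the range of [G], where [F] and [H]
     coincide. *)
  rewrite (_ : (fun n => _) = (fun n => (H t - H (u n)) / (t - u n)))//.
  by apply/funext => n; rewrite /u -bt -!FH.
Qed.

End quantile_conditioning.

Section unif01_rays.
Context {R : realType}.
Notation lam := (unif01 R).

Lemma unif01_ray (x : R) : 0 <= x -> x <= 1 -> lam `]-oo, x]%classic = x%:E.
Proof.
move=> x0 x1; transitivity (lam `]0, x]%classic).
  apply: ae_eq_measure => //; apply: filterS ae_unif01_in => t.
  by rewrite /= !in_itv /= => /andP[-> _].
by rewrite (unif01_itv _ _ (lexx 0) x0 x1) subr0.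
Qed.

Lemma unif01_gt1 : lam `]1, +oo[%classic = 0%E.
Proof.
rewrite -(measure0 lam); apply: ae_eq_measure => //.
apply: filterS ae_unif01_in => t.
by rewrite /= !in_itv /= andbT => /andP[_ /ltW]; rewrite leNgt => /negbTE ->.
Qed.

End unif01_rays.

(** * Margins, monotonicity and Lipschitz bounds of copulas *)

Section copula_theory.
Context {R : realType}.
Notation lam := (unif01 R).
Context (C : R -> R -> R) (cC : is_copula C).
Implicit Types (s t u v : R).

(** C u' w - C u w is the mass of the strip ]u, u'] x ]-oo, w], which grows with w. The monotonicity
    and Lipschitz bounds below are the cases where one side of the rectangle reaches 0 or 1. *)
Lemma copula_2increasing u u' v v' :
  0 <= u -> u <= u' -> u' <= 1 -> 0 <= v -> v <= v' -> v' <= 1 ->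
  C u' v - C u v <= C u' v' - C u v'.
Proof.
move=> u0 uu' u'1 v0 vv' v'1; have [m [m1 m2 mC]] := cC.
have E w : 0 <= w -> w <= 1 ->
    C u' w - C u w = fine (m (`]u, u']%classic `*` `]-oo, w]%classic)).
  move=> w0 w1; have ww : w \in `[0, 1] by rewrite in_itv /= w0.
  have mX (A : set R) : measurable A -> measurable (A `*` `]-oo, w]%classic).
    by move=> mA; exact: measurableX.
  rewrite !mC//; try by rewrite in_itv /= ?u0 ?(le_trans u0 uu') ?(le_trans uu' u'1).
  have -> : `]-oo, u']%classic `*` `]-oo, w]%classic =
      (`]-oo, u]%classic `*` `]-oo, w]%classic) `|`
      (`]u, u']%classic `*` `]-oo, w]%classic).
    apply/seteqP; split => -[x y]; rewrite /= !in_itv /=.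
      by move=> [-> ->]; rewrite andbT; case: (leP x u) => xu; [left|right].
    by move=> [[xu ->]|[/andP[_ ->] ->]] //; rewrite (le_trans xu).
  rewrite measureU//; try exact: mX.
    rewrite fineD ?fin_num_measure//; try exact: mX.
    by rewrite addrC addKr.
  apply/seteqP; split => // -[x y] [[/= + _] [/= + _]].
  by rewrite !in_itv /= => xu /andP[]; rewrite ltNge xu.
have v1 : v <= 1 by exact: le_trans v'1.
have v'0 : 0 <= v' by exact: le_trans vv'.
rewrite !E// fine_le ?fin_num_measure//; try exact: measurableX.
apply: le_measure; rewrite ?inE; try exact: measurableX.
by move=> [x y] [/= -> ]; split => //; move: b; rewrite /= !in_itv /= => /le_trans; exact.
Qed.

Let m_null (m : probability (R * R)%type R) (A B : set (R * R)) :
  measurable A -> measurable B -> A `<=` B -> m B = 0%E -> m A = 0%E.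
Proof. by move=> mA mB AB B0; exact: (@subset_measure0 _ _ _ m _ B). Qed.

Lemma copula0r u : 0 <= u <= 1 -> C u 0 = 0.
Proof.
move=> /andP[u0 u1]; have [m [m1 m2 mC]] := cC.
rewrite mC ?in_itv /= ?u0 ?lexx ?ler01// (m_null (B := setT `*` `]-oo, 0]%classic))//.
- exact: measurableX.
- exact: measurableX.
- by move=> [x y] [].
- exact: etrans (m2 _ (measurable_itv _)) (unif01_ray (lexx 0) ler01).
Qed.

Lemma copula0l v : 0 <= v <= 1 -> C 0 v = 0.
Proof.
move=> /andP[v0 v1]; have [m [m1 m2 mC]] := cC.
rewrite mC ?in_itv /= ?v0 ?lexx ?ler01// (m_null (B := `]-oo, 0]%classic `*` setT))//.
- exact: measurableX.
- exact: measurableX.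
- by move=> [x y] [].
- exact: etrans (m1 _ (measurable_itv _)) (unif01_ray (lexx 0) ler01).
Qed.

Lemma copula1r u : 0 <= u <= 1 -> C u 1 = u.
Proof.
move=> /andP[u0 u1]; have [m [m1 m2 mC]] := cC.
rewrite mC ?in_itv /= ?u0 ?lexx ?ler01//.
have := etrans (m1 _ (measurable_itv `]-oo, u])) (unif01_ray u0 u1).
rewrite (_ : _ `*` setT = (`]-oo, u]%classic `*` `]-oo, 1]%classic) `|`
                          (`]-oo, u]%classic `*` `]1, +oo[%classic)).
  rewrite measureU0; [by move=> ->|exact: measurableX|exact: measurableX|].
  apply: (m_null (B := setT `*` `]1, +oo[%classic)).
  - exact: measurableX.
  - exact: measurableX.
  - by move=> [x y] [].
  - exact: etrans (m2 _ (measurable_itv _)) unif01_gt1.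
apply/seteqP; split => -[x y]; rewrite /= !in_itv /= ?andbT.
  by move=> [-> _]; case: (leP y 1) => y1; [left|right].
by case=> -[].
Qed.

Lemma copula1l v : 0 <= v <= 1 -> C 1 v = v.
Proof.
move=> /andP[v0 v1]; have [m [m1 m2 mC]] := cC.
rewrite mC ?in_itv /= ?v0 ?lexx ?ler01//.
have := etrans (m2 _ (measurable_itv `]-oo, v])) (unif01_ray v0 v1).
rewrite (_ : setT `*` _ = (`]-oo, 1]%classic `*` `]-oo, v]%classic) `|`
                          (`]1, +oo[%classic `*` `]-oo, v]%classic)).
  rewrite measureU0; [by move=> ->|exact: measurableX|exact: measurableX|].
  apply: (m_null (B := `]1, +oo[%classic `*` setT)).
  - exact: measurableX.
  - exact: measurableX.
  - by move=> [x y] [].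
  - exact: etrans (m1 _ (measurable_itv _)) unif01_gt1.
apply/seteqP; split => -[x y]; rewrite /= !in_itv /= ?andbT.
  by move=> [_ ->]; case: (leP x 1) => y1; [left|right].
by case=> -[].
Qed.

Lemma copula_ndr u v v' : 0 <= u <= 1 -> 0 <= v -> v <= v' -> v' <= 1 ->
  C u v <= C u v'.
Proof.
move=> /andP[u0 u1] v0 vv' v1; have := copula_2increasing (lexx 0) u0 u1 v0 vv' v1.
by rewrite !copula0l ?subr0// ?v0 ?(le_trans vv') ?(le_trans v0).
Qed.

Lemma copula_lipr u v v' : 0 <= u <= 1 -> 0 <= v -> v <= v' -> v' <= 1 ->
  C u v' - C u v <= v' - v.
Proof.
move=> /andP[u0 u1] v0 vv' v1; have := copula_2increasing u0 u1 (lexx 1) v0 vv' v1.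
rewrite !copula1l ?v0 ?(le_trans vv') ?(le_trans v0)//; lra.
Qed.

Lemma copula_ndl u u' v : 0 <= v <= 1 -> 0 <= u -> u <= u' -> u' <= 1 ->
  C u v <= C u' v.
Proof.
move=> /andP[v0 v1] u0 uu' u1; have := copula_2increasing u0 uu' u1 (lexx 0) v0 v1.
by rewrite !copula0r ?subrr ?subr_ge0// ?u0 ?(le_trans uu') ?(le_trans u0).
Qed.

Lemma copula_lipl u u' v : 0 <= v <= 1 -> 0 <= u -> u <= u' -> u' <= 1 ->
  C u' v - C u v <= u' - u.
Proof.
move=> /andP[v0 v1] u0 uu' u1; have := copula_2increasing u0 uu' u1 v0 v1 (lexx 1).
by rewrite !copula1r ?u0 ?(le_trans uu') ?(le_trans u0).
Qed.

End copula_theory.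

(** * Measurable versions of the partial and generalized partial derivatives *)

Section copula_density.
Context {R : realType}.
Notation lam := (unif01 R).
Context (C : R -> R -> R) (cC : is_copula C).
Implicit Types (s t u v : R).

Definition sndR : R * R -> R := snd.

HB.instance Definition _ := isMeasurableFun.Build _ _ _ _ sndR measurable_snd.

(** [p] at t is the conditional probability, under the measure of the copula, that the first
    coordinate is at most [u] given that the second is t. The second margin being uniform, C u is an
    indefinite integral, with no appeal to absolute continuity of Lipschitz functions. *)
Lemma copula_integral u : 0 <= u <= 1 -> exists p : R -> R,
  [/\ measurable_fun setT p, lam.-integrable setT (EFin \o p) &
      forall v, 0 <= v <= 1 -> C u v = \int[lam]_(t in `]-oo, v]) p t].
Proof.
move=> u01; have [m [m1 m2 mC]] := cC.
pose A := `]-oo, u]%classic `*` [set: R].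
have mA : measurable A by exact: measurableX.
have iA : m.-integrable setT (EFin \o (\1_A : _ -> R)) by exact: integrable_indic.
have [p [mp ip pB]] := @cond_exp_exists _ _ _ m sndR _ iA.
have lawE B : measurable B -> distribution m sndR B = lam B.
  move=> mB; rewrite unif01E -m2//; congr (m _).
  by apply/seteqP; split => -[x y] //= [].
have integE B (f : R -> \bar R) : measurable B ->
    (\int[distribution m sndR]_(x in B) f x = \int[lam]_(x in B) f x)%E.
  by move=> mB; apply: eq_measure_integral => D mD _; exact: lawE.
have mEp : measurable_fun setT (EFin \o p) by exact/measurable_EFinP.
exists p; split => //.
  apply/integrableP; split => //; rewrite -integE//.
  rewrite ge0_integral_distribution//; last exact: measurableT_comp.
  by have /integrableP[] := ip.
move=> v v01; have /andP[v0 v1] := v01; have /andP[u0 u1] := u01.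
have mB : measurable (sndR @^-1` `]-oo, v]).
  by rewrite -[X in measurable X]setTI; exact: measurable_snd.
transitivity (\int[m]_(w in sndR @^-1` `]-oo, v]) p (sndR w)); last first.
  rewrite /Rintegral; congr fine; rewrite -integE//.
  by rewrite -(@integral_pushforward _ _ _ _ _ sndR _ m _ (EFin \o p))//;
    apply: integrableS ip.
rewrite pB// mC ?in_itv /= ?u0 ?v0//; rewrite /Rintegral; congr fine.
rewrite integral_indic//; congr (m _).
by apply/seteqP; split => -[x y] /= [xu yv]; do ?split => //; case: xu.
Qed.

Lemma near_in01 t : 0 < t < 1 -> \forall s \near t, 0 < s < 1.
Proof.
move=> t01; have := @near_in_itvoo R 0 1 t; rewrite in_itv /= => /(_ t01).
by apply: filterS => s; rewrite in_itv.
Qed.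

Lemma left_seq t : 0 < t -> exists a : nat -> R,
  a @ \oo --> t /\ forall n, 0 <= a n < t.
Proof.
move=> t0; exists (fun n => t - t * n.+2%:R^-1); split.
  rewrite -[X in _ --> X]subr0 -[X in _ - X](mulr0 t).
  apply: cvgB; first exact: cvg_cst.
  apply: cvgMr; have := @cvg_harmonic R; rewrite -(cvg_shiftS) /=; exact.
move=> n; apply/andP; split; last by rewrite gtrDl oppr_lt0 mulr_gt0// invr_gt0.
by rewrite subr_ge0 ger_pMr// invf_le1// ler1n.
Qed.

Lemma copula_derive01 u t : 0 <= u <= 1 -> 0 < t < 1 -> derivable (C u) t 1 ->
  0 <= partial2 C u t <= 1.
Proof.
move=> u01 t01 dC; have /andP[t0 t1] := t01.
have [a [at_ a01]] := left_seq t0.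
have cS := cvg_left_slope dC at_ (fun n => (andP (a01 n)).2).
apply/andP; split.
- apply: (cvgr_to_ge cS); apply: nearW => n; have /andP[a0 an] := a01 n.
  by apply: divr_ge0; rewrite subr_ge0 ?copula_ndr// ltW.
- apply: (cvgr_to_le cS); apply: nearW => n; have /andP[a0 an] := a01 n.
  by rewrite ler_pdivrMr ?subr_gt0// mul1r copula_lipr// ltW.
Qed.

(** A version of the derivative of C u that is measurable and bounded everywhere, and of which C u
    is the integral; the link with [partial2] itself holds almost everywhere only. *)
Definition is_partial2 u (p : R -> R) : Prop :=
  [/\ measurable_fun setT p, forall t, 0 <= p t <= 1,
      forall v, 0 <= v <= 1 -> C u v = \int[lam]_(t in `]-oo, v]) p t &
      {ae lam, forall t, derivable (C u) t 1 /\ partial2 C u t = p t}].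

Lemma copula_density u : 0 <= u <= 1 -> exists p, is_partial2 u p.
Proof.
move=> u01; have [p0 [mp ip pE]] := copula_integral u01.
have dp : {ae lam, forall t, [/\ derivable (C u) t 1, partial2 C u t = p0 t &
    0 <= p0 t <= 1]}.
  apply: filterS2 ae_unif01_in (unif01_FTC ip) => t /[!in_itv]/= t01 [dF F't].
  (* Off [0, 1] the values of C u are arbitrary, so derivatives are compared only near interior
     points. *)
  have E : \forall s \near t, (\int[lam]_(t in `]-oo, s]) p0 t) = C u s.
    apply: filterS (near_in01 t01) => s /andP[s0 s1].
    by rewrite pE// !ltW.
  have dC : derivable (C u) t 1 by exact: near_eq_derivable dF.
  have C't : partial2 C u t = p0 t.
    by rewrite -F't /partial2 !derive1E; apply/esym/near_eq_derive.
  by split=> //; rewrite -C't; exact: copula_derive01.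
(* The bounds inherited from the derivative hold almost everywhere; clamping makes them hold
   everywhere without changing any integral. *)
pose p t := Num.min 1 (Num.max 0 (p0 t)).
have mpp : measurable_fun setT p.
  by apply: measurable_minr => //; exact: measurable_maxr.
have p0E : {ae lam, forall t, p0 t = p t}.
  apply: filterS dp => t [_ _ /andP[q0 q1]].
  by rewrite /p max_r// min_r.
exists p; split => //.
- by move=> t; rewrite le_min ler01 le_max lexx ge_min lexx.
- by move=> v v01; rewrite pE//; exact: ae_eq_Rintegral.
- by apply: filterS2 dp p0E => t [dC -> _] ->.
Qed.

Definition is_gen_partial2 (G : R -> R) u (p phi : R -> R) : Prop :=
  [/\ measurable_fun setT phi, forall x, 0 <= phi x <= 1,
      {ae lam, forall t, gen_partial2 G C u t = phi (quant G t)} &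
      forall B, measurable B ->
        \int[lam]_(t in quant G @^-1` B) phi (quant G t) =
        \int[lam]_(t in quant G @^-1` B) p t].

Lemma gen_partial2_density (G : R -> R) u p : is_cdf G -> 0 <= u <= 1 ->
  is_partial2 u p -> exists phi, is_gen_partial2 G u p phi.
Proof.
move=> hG u01 [mp p01 pE dp].
have ip := bounded01_integrable lam mp p01.
have [phi [mphi iphi phiB]] := @cond_exp_exists _ _ _ lam (quantRV hG) _ ip.
have phiE := cond_exp_quant hG ip mphi iphi phiB.
have gE : {ae lam, forall t, gen_partial2 G C u t = phi (quant G t) /\
    0 <= phi (quant G t) <= 1}.
  apply: filterS2 dp phiE => t [_ dC] ->; rewrite /gen_partial2 /=.
  set a := left_version _ _; set b := G _.
  have a01 : 0 <= a <= 1 by exact: left_version01.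
  have b01 : 0 <= b <= 1 by exact: is_cdf01.
  case: ifPn => ab; last by rewrite dC p01.
  rewrite -!pE//; split => //; have /andP[a0 a1] := a01; have /andP[b0 b1] := b01.
  have ab' := ltW ab; rewrite divr_ge0 ?subr_ge0 ?copula_ndr//=.
  by rewrite ler_pdivrMr ?subr_gt0// mul1r copula_lipr.
pose psi x := Num.min 1 (Num.max 0 (phi x)).
have mpsi : measurable_fun setT psi.
  by apply: measurable_minr => //; exact: measurable_maxr.
have psiE : {ae lam, forall t, phi (quant G t) = psi (quant G t)}.
  apply: filterS gE => t [_ /andP[p0 p1]].
  by rewrite /psi max_r// min_r.
have mq := measurable_quant hG.
exists psi; split => //.
- by move=> t; rewrite le_min ler01 le_max lexx ge_min lexx.
- by apply: filterS2 gE psiE => t [-> _].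
- move=> B mB; rewrite -phiB//; apply/esym/ae_eq_Rintegral => //.
  + by rewrite -[X in measurable X]setTI; exact: mq.
  + exact: measurableT_comp.
Qed.

End copula_density.

(** * The L1 distance on [0, 1] through representatives *)

Section L1_distance.
Context {R : realType}.
Notation mu := (@lebesgue_measure R).
Notation lam := (unif01 R).
Implicit Types (f g h : R -> R).

Lemma ae_unif01_lebesgue (Q : R -> Prop) :
  {ae lam, forall t, Q t} -> {ae mu, forall t, `[0, 1]%classic t -> Q t}.
Proof.
move=> [N [mN N0 NQ]]; exists (N `&` `[0, 1]); split.
- exact: measurableI.
- by rewrite -unif01_mu.
- move=> t /= /not_implyP[t01 nQ]; split => //; exact: NQ.
Qed.

Lemma integral01_ae f g : measurable_fun setT g ->
  {ae lam, forall t, f t = g t} ->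
  (\int[mu]_(t in `[0%R, 1%R]) (f t)%:E = \int[lam]_t (g t)%:E)%E.
Proof.
move=> mg fg; rewrite integral_unif01; last exact/measurable_EFinP.
apply: ae_eq_integral_nonmeasurable => //.
  by apply/measurable_EFinP; exact: measurable_funTS.
have := ae_unif01_lebesgue fg; apply: filterS; first exact: (ae_filter_ringOfSetsType mu).
by move=> t h /h ->.
Qed.

(* [f] need not be measurable: it agrees with [g] almost everywhere only. *)
Definition represents f g : Prop :=
  [/\ measurable_fun setT g, forall t, 0 <= g t <= 1 &
      {ae lam, forall t, f t = g t}].

Definition L1dist f g : R := \int[mu]_(t in `[0, 1]) `|f t - g t|.

Lemma L1distE f f' g g' : represents f f' -> represents g g' ->
  L1dist f g = \int[lam]_t `|f' t - g' t|.
Proof.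
move=> [mf f01 ff'] [mg g01 gg']; congr fine; apply: integral01_ae.
  by apply: measurableT_comp => //; exact: measurable_funB.
by apply: filterS2 ff' gg' => t -> ->.
Qed.

Lemma integrable_distL1 f g : measurable_fun setT f -> measurable_fun setT g ->
  (forall t, 0 <= f t <= 1) -> (forall t, 0 <= g t <= 1) ->
  lam.-integrable setT (EFin \o (fun t => `|f t - g t|)).
Proof.
move=> mf mg f01 g01; apply: bounded01_integrable.
  by apply: measurableT_comp => //; exact: measurable_funB.
move=> t; rewrite normr_ge0 /= ler_norml.
by have /andP[f0 f1] := f01 t; have /andP[g0 g1] := g01 t; apply/andP; split; lra.
Qed.

Lemma integrable_addR f g : lam.-integrable setT (EFin \o f) ->
  lam.-integrable setT (EFin \o g) ->
  lam.-integrable setT (EFin \o (fun t => f t + g t)).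
Proof. by move=> fi gi; exact: (integrableD measurableT fi gi). Qed.

Lemma integrable_subR f g : lam.-integrable setT (EFin \o f) ->
  lam.-integrable setT (EFin \o g) ->
  lam.-integrable setT (EFin \o (fun t => f t - g t)).
Proof. by move=> fi gi; exact: (integrableB measurableT fi gi). Qed.

Lemma L1dist_triangle f g h f' g' h' :
  represents f f' -> represents g g' -> represents h h' ->
  L1dist f h <= L1dist f g + L1dist g h.
Proof.
move=> rf rg rh; rewrite (L1distE rf rg) (L1distE rf rh) (L1distE rg rh).
move: rf rg rh => [mf f01 _] [mg g01 _] [mh h01 _].
rewrite -RintegralD//; try exact: integrable_distL1.
apply: le_Rintegral => //; try exact: integrable_distL1.
  by apply: integrable_addR; exact: integrable_distL1.
by move=> t _; rewrite -(subrKA (g' t)) ler_normD.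
Qed.

Lemma L1distC f g : L1dist f g = L1dist g f.
Proof. by apply: eq_Rintegral => t _; rewrite distrC. Qed.

Lemma L1dist_ge0 f g : 0 <= L1dist f g.
Proof. exact: Rintegral_ge0. Qed.

Lemma Rintegral01M_ae f f' g g' : represents f f' -> represents g g' ->
  \int[mu]_(t in `[0, 1]) (f t * g t) = \int[lam]_t (f' t * g' t).
Proof.
move=> [mf f01 ff'] [mg g01 gg']; congr fine; apply: integral01_ae.
  exact: measurable_funM.
by apply: filterS2 ff' gg' => t -> ->.
Qed.

Lemma Rintegral_mul_dist f g h k f' g' h' k' :
  represents f f' -> represents g g' -> represents h h' -> represents k k' ->
  `|\int[mu]_(t in `[0, 1]) (f t * g t) - \int[mu]_(t in `[0, 1]) (h t * k t)|
    <= L1dist f h + L1dist g k.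
Proof.
move=> rf rg rh rk; rewrite (Rintegral01M_ae rf rg) (Rintegral01M_ae rh rk).
rewrite (L1distE rf rh) (L1distE rg rk).
move: rf rg rh rk => [mf f01 _] [mg g01 _] [mh h01 _] [mk k01 _].
have iM (a b : R -> R) : measurable_fun setT a -> measurable_fun setT b ->
    (forall t, 0 <= a t <= 1) -> (forall t, 0 <= b t <= 1) ->
    lam.-integrable setT (EFin \o (fun t => a t * b t)).
  move=> ma mb a01 b01; apply: bounded01_integrable; first exact: measurable_funM.
  move=> t; have /andP[a0 a1] := a01 t; have /andP[b0 b1] := b01 t.
  by rewrite mulr_ge0//= mulr_ile1.
rewrite -RintegralB//; try exact: iM.
have iB : lam.-integrable setT (EFin \o (fun t => f' t * g' t - h' t * k' t)).
  by apply: integrable_subR; exact: iM.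
apply: le_trans (le_normr_Rintegral measurableT iB) _.
rewrite -RintegralD//; try exact: integrable_distL1.
apply: le_Rintegral => //.
- exact: integrable_norm iB.
- by apply: integrable_addR; exact: integrable_distL1.
move=> t _; have /andP[f0 f1] := f01 t; have /andP[g0 g1] := g01 t.
have /andP[h0 h1] := h01 t; have /andP[k0 k1] := k01 t.
have -> : f' t * g' t - h' t * k' t = (f' t - h' t) * g' t + h' t * (g' t - k' t).
  by ring.
apply: le_trans (ler_normD _ _) _; rewrite !normrM (ger0_norm g0) (ger0_norm h0).
by rewrite lerD// ?ler_piMr// ler_piMl.
Qed.

Lemma cvg_L1dist (f_ f'_ : nat -> R -> R) f f' :
  (forall n, represents (f_ n) (f'_ n)) -> represents f f' ->
  {ae lam, forall t, f_ n t @[n --> \oo] --> f t} ->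
  L1dist (f_ n) f @[n --> \oo] --> 0.
Proof.
move=> rf_ rf cf; have [mf f01 ff'] := rf.
have : \int[lam]_t `|f'_ n t - f' t| @[n --> \oo] --> (0 : R).
  have ffn : {ae lam, forall t, forall n, f_ n t = f'_ n t}.
    by apply/ae_foralln => n; have [] := rf_ n.
  have [||||c _] := @cvg_Rintegral_bounded _ _ _ lam 1 f'_ f'; last exact: c.
  - by move=> n; have [] := rf_ n.
  - by [].
  - by move=> n t; have [_ /(_ t)/andP[h0 h1] _] := rf_ n; rewrite ger0_norm.
  apply: filterS3 ffn ff' cf => t fn ff c.
  by rewrite -ff; move: c; under eq_fun do rewrite fn.
apply: cvg_trans; apply: near_eq_cvg; apply: nearW => n /=.
by rewrite (L1distE (rf_ n) rf).
Qed.

End L1_distance.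

(** * Stability of generalized partial derivatives in L1 *)

Section gen_partial2_distance.
Context {R : realType}.
Notation mu := (@lebesgue_measure R).
Notation lam := (unif01 R).
Implicit Types (G : R -> R) (C : R -> R -> R) (t u v : R).

Lemma partial2_represents C u p : is_partial2 C u p -> represents (partial2 C u) p.
Proof. by move=> [mp p01 _ dp]; split => //; apply: filterS dp => t []. Qed.

Lemma gen_partial2_represents G C u p phi : is_cdf G -> is_gen_partial2 C G u p phi ->
  represents (gen_partial2 G C u) (phi \o quant G).
Proof.
move=> hG [mphi phi01 phiE _]; split => //.
  by apply: measurableT_comp => //; exact: measurable_quant.
by move=> t; exact: phi01.
Qed.

Lemma gen_partial2_representsP G C u : is_cdf G -> is_copula C -> 0 <= u <= 1 ->
  exists f, represents (gen_partial2 G C u) f.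
Proof.
move=> hG cC u01; have [p hp] := copula_density cC u01.
have [phi hphi] := gen_partial2_density cC hG u01 hp.
by exists (phi \o quant G); exact: gen_partial2_represents hphi.
Qed.

(** The difference of the two functions [phi] along [quant G] is the conditional expectation of p -
    p', and the set where it is nonnegative is a preimage under [quant G], as [le_norm1_cond_exp]
    requires. With u = u' this transfers the convergence of copulas; with C = C' it gives the
    Lipschitz bound in [u]. *)
Lemma gen_partial2_contraction G C C' u u' : is_cdf G ->
  is_copula C -> is_copula C' -> 0 <= u <= 1 -> 0 <= u' <= 1 ->
  L1dist (gen_partial2 G C u) (gen_partial2 G C' u') <=
  L1dist (partial2 C u) (partial2 C' u').
Proof.
move=> hG cC cC' u01 u'01; have [p hp] := copula_density cC u01.
have [phi hphi] := gen_partial2_density cC hG u01 hp.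
have [p' hp'] := copula_density cC' u'01.
have [phi' hphi'] := gen_partial2_density cC' hG u'01 hp'.
have rphi := gen_partial2_represents hG hphi.
have rphi' := gen_partial2_represents hG hphi'.
rewrite (L1distE rphi rphi').
rewrite (L1distE (partial2_represents hp) (partial2_represents hp')).
move: rphi rphi' hp hp' hphi hphi' => [mf f01 _] [mf' f'01 _] [mp p01 _ _].
move=> [mp' p'01 _ _] [mphi _ _ phiB] [mphi' _ _ phi'B].
have mq := measurable_quant hG.
have fi := bounded01_integrable lam mf f01; have f'i := bounded01_integrable lam mf' f'01.
have pi_ := bounded01_integrable lam mp p01; have p'i := bounded01_integrable lam mp' p'01.
have qE B : measurable B ->
    \int[lam]_(t in quant G @^-1` B) (phi (quant G t) - phi' (quant G t)) =
    \int[lam]_(t in quant G @^-1` B) (p t - p' t).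
  move=> mB; have mqB : measurable (quant G @^-1` B).
    by rewrite -[X in measurable X]setTI; exact: mq.
  rewrite !RintegralB//; first by rewrite phiB// phi'B.
  - exact: integrableS pi_.
  - exact: integrableS p'i.
  - exact: integrableS fi.
  - exact: integrableS f'i.
apply: le_norm1_cond_exp; try exact: integrable_subR.
- apply: (qE [set x | 0 <= phi x - phi' x]).
  rewrite (_ : [set x | _] = (fun x => phi x - phi' x) @^-1` `[0, +oo[).
    by rewrite -[X in measurable X]setTI; exact: measurable_funB.
  by apply/seteqP; split => x /=; rewrite in_itv /= andbT.
- apply: (qE (~` [set x | 0 <= phi x - phi' x])); apply: measurableC.
  rewrite (_ : [set x | _] = (fun x => phi x - phi' x) @^-1` `[0, +oo[).
    by rewrite -[X in measurable X]setTI; exact: measurable_funB.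
  by apply/seteqP; split => x /=; rewrite in_itv /= andbT.
Qed.

Lemma partial2_mean C u p : is_copula C -> 0 <= u <= 1 -> is_partial2 C u p ->
  \int[lam]_t p t = u.
Proof.
move=> cC u01 [mp p01 pE _]; rewrite -[RHS](copula1r cC u01).
rewrite pE ?ler01 ?lexx//; apply: ae_eq_set_Rintegral => //.
apply: filterS ae_unif01_in => t /[!in_itv]/= /andP[_ t1].
by split => // _; rewrite /= in_itv /= ltW.
Qed.

(** Since a copula is 2-increasing, its slopes in the second variable grow with [u]. The absolute
    value can thus be dropped, and what remains is the difference of the means u' and u. *)
Lemma L1dist_partial2 C u u' : is_copula C -> 0 <= u -> u <= u' -> u' <= 1 ->
  L1dist (partial2 C u) (partial2 C u') = u' - u.
Proof.
move=> cC u0 uu' u'1.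
have u01 : 0 <= u <= 1 by rewrite u0 (le_trans uu').
have u'01 : 0 <= u' <= 1 by rewrite (le_trans u0).
have [p hp] := copula_density cC u01.
have [p' hp'] := copula_density cC u'01.
rewrite (L1distE (partial2_represents hp) (partial2_represents hp')).
rewrite -(partial2_mean cC u01 hp) -(partial2_mean cC u'01 hp').
move: hp hp' => [mp p01 _ dp] [mp' p'01 _ dp'].
rewrite -RintegralB//; try exact: bounded01_integrable.
apply: ae_eq_Rintegral => //; first exact: measurable_funB.
apply: filterS3 ae_unif01_in dp dp' => t /[!in_itv]/= /andP[t0 t1].
move=> [dC C't] [dC' C't'].
suff pp' : p t <= p' t by rewrite distrC ger0_norm// subr_ge0.
have [a [at_ a01]] := left_seq t0.
have cS := cvg_left_slope dC at_ (fun n => (andP (a01 n)).2).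
have cS' := cvg_left_slope dC' at_ (fun n => (andP (a01 n)).2).
rewrite -C't -C't'; apply: (ler_cvg_to cS cS'); apply: nearW => n.
have /andP[a0 at'] := a01 n.
rewrite ler_pM2r ?invr_gt0 ?subr_gt0//.
have := copula_2increasing cC u0 uu' u'1 a0 (ltW at') (ltW t1); lra.
Qed.

Lemma gen_partial2_lip G C u u' : is_cdf G -> is_copula C ->
  0 <= u -> u <= u' -> u' <= 1 ->
  L1dist (gen_partial2 G C u) (gen_partial2 G C u') <= u' - u.
Proof.
move=> hG cC u0 uu' u'1; rewrite -(L1dist_partial2 cC u0 uu' u'1).
by apply: gen_partial2_contraction => //; rewrite ?u0 ?(le_trans uu') ?(le_trans u0).
Qed.

Lemma copula_dist C u s t : is_copula C -> 0 <= u <= 1 -> 0 <= s <= 1 ->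
  0 <= t <= 1 -> `|C u s - C u t| <= `|s - t|.
Proof.
move=> cC u01; wlog st : s t / s <= t => [H s01 t01|].
  have [st|/ltW ts] := leP s t; first exact: H.
  by rewrite distrC [leRHS]distrC; exact: H.
move=> /andP[s0 s1] /andP[t0 t1].
rewrite distrC [leRHS]distrC !ger0_norm ?subr_ge0 ?copula_ndr//.
by rewrite copula_lipr.
Qed.

Lemma cvg_copula C u (a : nat -> R) t : is_copula C -> 0 <= u <= 1 ->
  (forall n, 0 <= a n <= 1) -> 0 <= t <= 1 -> a @ \oo --> t ->
  C u (a n) @[n --> \oo] --> C u t.
Proof.
move=> cC u01 a01 t01 at_; apply/cvgrPdist_lt => e e0; near=> n.
apply: (@le_lt_trans _ _ `|t - a n|); first exact: copula_dist.
by near: n; move/cvgrPdist_lt : at_; exact.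
Unshelve. all: by end_near. Qed.

Lemma cvg_gen_partial2 (Gn : nat -> R -> R) G C u t :
  (forall n, is_cdf (Gn n)) -> is_cdf G -> is_copula C -> 0 <= u <= 1 ->
  0 < t < 1 -> derivable (C u) t 1 ->
  Gn n (ginv (Gn n) t) @[n --> \oo] --> G (ginv G t) ->
  left_version (Gn n) (ginv (Gn n) t) @[n --> \oo] --> left_version G (ginv G t) ->
  gen_partial2 (Gn n) C u t @[n --> \oo] --> gen_partial2 G C u t.
Proof.
move=> hGn hG cC u01 t01 dC cb ca; rewrite /gen_partial2.
have tb : t <= G (ginv G t) by exact: le_cdf_ginv.
have at_ : left_version G (ginv G t) <= t by exact: left_version_ginv_le.
set a := left_version G (ginv G t) in ca at_ *; set b := G (ginv G t) in cb tb *.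
have a01 : 0 <= a <= 1 by exact: left_version01.
have b01 : 0 <= b <= 1 by exact: is_cdf01.
case: ltP => [ab|ba].
- have cC1 := cvg_copula cC u01 (fun n => is_cdf01 _ (hGn n)) b01 cb.
  have cC2 := cvg_copula cC u01 (fun n => left_version01 _ (hGn n)) a01 ca.
  have ba0 : b - a != 0 by rewrite subr_eq0 gt_eqF.
  have : (C u (Gn n (ginv (Gn n) t)) - C u (left_version (Gn n) (ginv (Gn n) t))) /
      (Gn n (ginv (Gn n) t) - left_version (Gn n) (ginv (Gn n) t)) @[n --> \oo]
      --> (C u b - C u a) / (b - a).
    by apply: cvgM; [exact: cvgB|apply: cvgV => //; exact: cvgB].
  apply: cvg_trans; apply: near_eq_cvg; near=> n => /=.
  (* The midpoint of a < b eventually separates the n-th left limit from the n-th value, so the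
     quotient branch is taken. *)
  rewrite ifT//; apply: (@lt_trans _ _ ((a + b) / 2)).
    by near: n; apply: (@cvgr_lt R _ _ _ _ _ ca); lra.
  by near: n; apply: (@cvgr_gt R _ _ _ _ _ cb); lra.
- have bt : b = t by apply/eqP; rewrite eq_le tb (le_trans ba).
  have at' : a = t by apply/eqP; rewrite eq_le at_ -bt.
  rewrite at' in ca; rewrite bt in cb; apply/cvgrPdist_le => e e0.
  have [r r0 fr] := derivable_slope_near dC e0.
  (* Either the n-th term is a slope over an interval straddling [t], or it is already the
     derivative at [t]. *)
  near=> n; case: ifPn => [abn|_]; last by rewrite subrr normr0 ltW.
  apply: fr => //.
  + by near: n; move/cvgrPdist_lt : ca; exact.
  + by near: n; move/cvgrPdist_lt : cb; exact.
  + by rewrite left_version_ginv_le//= le_cdf_ginv.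
Unshelve. all: by end_near. Qed.

Lemma cvg_L1dist_gen_partial2_cdf (Gn : nat -> R -> R) G C u :
  (forall n, is_cdf (Gn n)) -> is_cdf G -> is_copula C -> 0 <= u <= 1 ->
  {ae lam, forall t, Gn n (ginv (Gn n) t) @[n --> \oo] --> G (ginv G t)} ->
  L1dist (gen_partial2 (Gn n) C u) (gen_partial2 G C u) @[n --> \oo] --> 0.
Proof.
move=> hGn hG cC u01 cb.
have ca := ae_cvg_left_version_ginv hGn hG cb.
have [p [_ _ _ dp]] := copula_density cC u01.
have [f fE] : exists f, forall n, represents (gen_partial2 (Gn n) C u) (f n).
  have /choice[f fE] := fun n => gen_partial2_representsP (hGn n) cC u01.
  by exists f.
have [g gE] := gen_partial2_representsP hG cC u01.
apply: (cvg_L1dist fE gE).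
have cab : {ae lam, forall t, (Gn n (ginv (Gn n) t) @[n --> \oo] --> G (ginv G t)) /\
    (left_version (Gn n) (ginv (Gn n) t) @[n --> \oo] --> left_version G (ginv G t))}.
  by apply: filterS2 ca cb => t.
apply: filterS3 ae_unif01_in dp cab => t /[!in_itv]/= t01 [dC _] [cbt cat].
exact: cvg_gen_partial2.
Qed.

Lemma cvg_L1dist_gen_partial2 (Gn : nat -> R -> R) G (Cn : nat -> R -> R -> R) C u :
  (forall n, is_cdf (Gn n)) -> is_cdf G ->
  (forall n, is_copula (Cn n)) -> is_copula C -> 0 <= u <= 1 ->
  cvg_partial2 Cn C ->
  {ae lam, forall t, Gn n (ginv (Gn n) t) @[n --> \oo] --> G (ginv G t)} ->
  L1dist (gen_partial2 (Gn n) (Cn n) u) (gen_partial2 G C u) @[n --> \oo] --> 0.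
Proof.
move=> hGn hG cCn cC u01 cCnC cb.
have cp : L1dist (partial2 (Cn n) u) (partial2 C u) @[n --> \oo] --> 0.
  have /fine_cvgP[_] : (\int[mu]_(t in `[0%R, 1%R])
      `|partial2 (Cn n) u t - partial2 C u t|%:E)%E @[n --> \oo] --> 0%:E.
    by apply: cCnC; rewrite in_itv.
  exact.
have cG := cvg_L1dist_gen_partial2_cdf hGn hG cC u01 cb.
have cS : L1dist (partial2 (Cn n) u) (partial2 C u) +
    L1dist (gen_partial2 (Gn n) C u) (gen_partial2 G C u) @[n --> \oo] --> (0 : R).
  by rewrite -[X in _ --> X]addr0; exact: cvgD.
apply: (squeeze_cvgr _ _ cS); last exact: cvg_cst.
apply: nearW => n.
rewrite L1dist_ge0 /=.
have [f fE] := gen_partial2_representsP (hGn n) (cCn n) u01.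
have [g gE] := gen_partial2_representsP (hGn n) cC u01.
have [h hE] := gen_partial2_representsP hG cC u01.
apply: le_trans (L1dist_triangle fE gE hE) _.
by rewrite lerD2r; exact: gen_partial2_contraction.
Qed.

(* [gen_partial2 G C u] is 1-Lipschitz in [u] for [L1dist], so the convergence
   on a finite grid suffices. *)
Lemma near_L1dist_gen_partial2 (Gn : nat -> R -> R) G (Cn : nat -> R -> R -> R) C e :
  (forall n, is_cdf (Gn n)) -> is_cdf G ->
  (forall n, is_copula (Cn n)) -> is_copula C ->
  cvg_partial2 Cn C ->
  {ae lam, forall t, Gn n (ginv (Gn n) t) @[n --> \oo] --> G (ginv G t)} ->
  0 < e -> \forall n \near \oo, forall u, 0 <= u <= 1 ->
    L1dist (gen_partial2 (Gn n) (Cn n) u) (gen_partial2 G C u) <= e.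
Proof.
move=> hGn hG cCn cC cCnC cb e0.
(* Budget: e / 2 at the grid point, and one Lipschitz correction of at most 1 / N <= e / 4 for each
   of the two copulas. *)
have e4 : 0 < e / 4 by rewrite divr_gt0.
pose N := (Num.truncn (4 / e)).+1.
have N0 : (0 < N%:R :> R) by rewrite ltr0n.
have NE : N%:R^-1 <= e / 4.
  rewrite -[leRHS]invrK lef_pV2 ?posrE ?invr_gt0// invf_div.
  by rewrite ltW// truncnS_gt.
have grid : \forall n \near \oo, forall i : 'I_N,
    L1dist (gen_partial2 (Gn n) (Cn n) (i%:R / N%:R)) (gen_partial2 G C (i%:R / N%:R))
      <= e / 2.
  apply: filter_forall => i.
  have i01 : 0 <= (i%:R / N%:R : R) <= 1.
    by rewrite divr_ge0//= ler_pdivrMr// mul1r ler_nat ltnW.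
  have := cvg_L1dist_gen_partial2 hGn hG cCn cC i01 cCnC cb.
  move/cvgrPdist_le => /(_ (e / 2)); rewrite divr_gt0// => /(_ isT).
  by apply: filterS => n; rewrite sub0r normrN ger0_norm ?L1dist_ge0.
apply: filterS grid => n grid u /andP[u0 u1].
have [i [i0 iu uN]] : exists i : 'I_N, [/\ 0 <= (i%:R / N%:R : R), i%:R / N%:R <= u &
    u - i%:R / N%:R <= N%:R^-1].
  (* At u = 1 rounding down would give the index N, outside 'I_N; the last grid point (N - 1) / N is
     still within 1 / N. *)
  have [->|u_neq1] := eqVneq u 1.
    exists ord_max => /=; split; first by rewrite divr_ge0.
      by rewrite ler_pdivrMr// mul1r ler_nat.
    rewrite -[X in X - _](divff (lt0r_neq0 N0)) -mulrBl -natrB//.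
    by rewrite subSnn mul1r.
  have uN0 : 0 <= u * N%:R by rewrite mulr_ge0.
  have iN : (Num.truncn (u * N%:R) < N)%N.
    by rewrite truncn_lt_nat// gtr_pMl// lt_neqAle u_neq1.
  exists (Ordinal iN) => /=; split; first by rewrite divr_ge0.
    by rewrite ler_pdivrMr// truncn_le.
  rewrite -[leRHS]mul1r lerBlDr -mulrDl ler_pdivlMr// nat1r.
  by rewrite ltW// truncnS_gt.
have i1 : i%:R / N%:R <= 1 :> R by exact: le_trans iu u1.
have u01 : 0 <= u <= 1 by rewrite u0.
have i01 : 0 <= (i%:R / N%:R : R) <= 1 by rewrite i0.
have [f1 r1] := gen_partial2_representsP (hGn n) (cCn n) u01.
have [f2 r2] := gen_partial2_representsP (hGn n) (cCn n) i01.
have [f3 r3] := gen_partial2_representsP hG cC i01.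
have [f4 r4] := gen_partial2_representsP hG cC u01.
have h1 := L1dist_triangle r1 r2 r4; have h2 := L1dist_triangle r2 r3 r4.
have h3 := gen_partial2_lip (hGn n) (cCn n) i0 iu u1; rewrite L1distC in h3.
have h4 := gen_partial2_lip hG cC i0 iu u1.
apply: le_trans h1 _; apply: le_trans (lerD h3 (le_trans h2 (lerD (grid i) h4))) _.
have arith (w x : R) : u - w <= x -> x <= e / 4 -> u - w + (e / 2 + (u - w)) <= e.
  by clear; lra.
exact: arith uN NE.
Qed.

End gen_partial2_distance.

(** * Convergence and regularity of conditional independence products *)

Section ci_product_convergence.
Context {R : realType}.
Notation mu := (@lebesgue_measure R).
Notation lam := (unif01 R).
Implicit Types (G : R -> R) (C : R -> R -> R) (t u v : R).

Lemma ci_product_dist G C G' C' u v u' v' :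
  is_cdf G -> is_copula C -> is_cdf G' -> is_copula C' ->
  0 <= u <= 1 -> 0 <= v <= 1 -> 0 <= u' <= 1 -> 0 <= v' <= 1 ->
  `|ci_product G C u v - ci_product G' C' u' v'| <=
  L1dist (gen_partial2 G C u) (gen_partial2 G' C' u') +
  L1dist (gen_partial2 G C v) (gen_partial2 G' C' v').
Proof.
move=> hG cC hG' cC' u01 v01 u'01 v'01.
have [f1 r1] := gen_partial2_representsP hG cC u01.
have [f2 r2] := gen_partial2_representsP hG cC v01.
have [f3 r3] := gen_partial2_representsP hG' cC' u'01.
have [f4 r4] := gen_partial2_representsP hG' cC' v'01.
exact: Rintegral_mul_dist r1 r2 r3 r4.
Qed.

Lemma near_ci_product (Gn : nat -> R -> R) G (Cn : nat -> R -> R -> R) C e :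
  (forall n, is_cdf (Gn n)) -> is_cdf G ->
  (forall n, is_copula (Cn n)) -> is_copula C ->
  cvg_partial2 Cn C ->
  {ae lam, forall t, Gn n (ginv (Gn n) t) @[n --> \oo] --> G (ginv G t)} ->
  0 < e -> \forall n \near \oo, forall u v, 0 <= u <= 1 -> 0 <= v <= 1 ->
    `|ci_product (Gn n) (Cn n) u v - ci_product G C u v| <= e.
Proof.
move=> hGn hG cCn cC cCnC cb e0.
have := @near_L1dist_gen_partial2 R Gn G Cn C (e / 2) hGn hG cCn cC cCnC cb.
rewrite divr_gt0// => /(_ isT); apply: filterS => n H u v u01 v01.
apply: le_trans (ci_product_dist _ _ _ _ _ _ _ _) _ => //.
by rewrite [leRHS]splitr lerD// H.
Qed.

Lemma ci_product_diag_lip G C u v : is_cdf G -> is_copula C ->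
  0 <= u -> u <= v -> v <= 1 ->
  `|ci_product G C u u - ci_product G C v v| <= 2 * (v - u).
Proof.
move=> hG cC u0 uv v1; have u01 : 0 <= u <= 1 by rewrite u0 (le_trans uv).
have v01 : 0 <= v <= 1 by rewrite (le_trans u0).
apply: le_trans (ci_product_dist hG cC hG cC u01 u01 v01 v01) _.
by rewrite mulr_natl mulr2n lerD// gen_partial2_lip.
Qed.

Lemma ci_product_diag_dist G C u v : is_cdf G -> is_copula C ->
  0 <= u <= 1 -> 0 <= v <= 1 ->
  `|ci_product G C u u - ci_product G C v v| <= 2 * `|u - v|.
Proof.
move=> hG cC; wlog uv : u v / u <= v => [H u01 v01|/andP[u0 u1] /andP[v0 v1]].
  have [uv|/ltW vu] := leP u v; first exact: H.
  by rewrite distrC [`|u - v|]distrC; exact: H.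
by rewrite [`|u - v|]distrC (ger0_norm (_ : 0 <= v - u)) ?subr_ge0// ci_product_diag_lip.
Qed.

Lemma ci_product_diag01 G C u : is_cdf G -> is_copula C -> 0 <= u <= 1 ->
  0 <= @ci_product R G C u u <= 1.
Proof.
move=> hG cC u01; have [f rf] := gen_partial2_representsP hG cC u01.
rewrite /ci_product (Rintegral01M_ae rf rf).
have [mf f01 _] := rf.
have f0 t : 0 <= f t * f t by have /andP[? _] := f01 t; rewrite mulr_ge0.
have f1 t : f t * f t <= 1 by have /andP[? ?] := f01 t; rewrite mulr_ile1.
rewrite Rintegral_ge0//=.
have -> : 1 = \int[lam]_t (1 : R).
  by rewrite Rintegral_cst// mul1r [fine _](congr1 fine (probability_setT lam)).
apply: le_Rintegral => //.
- apply: bounded01_integrable; first exact: measurable_funM.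
  by move=> t; rewrite f0 f1.
- exact: finite_measure_integrable_cst.
Qed.

(** The diagonal is known to be Lipschitz on [0, 1] only. Clamping the argument makes it continuous
    on the whole line, hence measurable. *)
Lemma measurable_ci_product_diag G C : is_cdf G -> is_copula C ->
  measurable_fun setT (fun u : R => @ci_product R G C (Num.min 1 (Num.max 0 u))
                                                  (Num.min 1 (Num.max 0 u))).
Proof.
move=> hG cC; apply: continuous_measurable_fun => u.
pose clamp (v : R) := Num.min 1 (Num.max 0 v).
have clamp01 v : 0 <= clamp v <= 1.
  by rewrite le_min ler01 le_max lexx ge_min lexx.
have clamp_dist v w : `|clamp v - clamp w| <= `|v - w|.
  have /andP[v0 v1] := clamp01 v; have /andP[w0 w1] := clamp01 w; move: v0 v1 w0 w1.
  rewrite /clamp !minEle !maxEle.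
  by repeat case: ifPn; rewrite -?ltNge => *; rewrite ler_norml;
    have := ler_norm (v - w); have := ler_normr (w - v) (v - w); lra.
apply/cvgrPdist_lt => e e0.
have e2 : 0 < e / 2 by rewrite divr_gt0.
near=> v.
apply: le_lt_trans (ci_product_diag_dist hG cC (clamp01 u) (clamp01 v)) _.
apply: (@le_lt_trans _ _ (2 * `|u - v|)); first by rewrite ler_pM2l.
rewrite mulrC -ltr_pdivlMr//; near: v; exact: cvgr_dist_lt.
Unshelve. all: by end_near. Qed.

Lemma measurable_ci_product_comp d (T : measurableType d) G C (a : T -> R) :
  is_cdf G -> is_copula C -> measurable_fun setT a -> (forall x, 0 <= a x <= 1) ->
  measurable_fun setT (fun x => ci_product G C (a x) (a x)).
Proof.
move=> hG cC ma a01; have := measurableT_comp (measurable_ci_product_diag hG cC) ma.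
apply: eq_measurable_fun => x _ /=; have /andP[a0 a1] := a01 x.
by have -> : Num.min 1 (Num.max 0 (a x)) = a x by rewrite max_r ?min_r.
Qed.

End ci_product_convergence.

(** * Distribution functions and copulas of random variables *)

Section cdfR_theory.
Context d (T : measurableType d) (R : realType) (P : probability T R).
Notation lam := (unif01 R).
Implicit Types (X Y : {RV P >-> R}).

Lemma cdfRE X x : (cdfR X x)%:E = cdf X x.
Proof. by rewrite /cdfR fineK// fin_num_measure. Qed.

Lemma is_cdf_cdfR X : is_cdf (cdfR X).
Proof.
split.
- move=> x y xy; rewrite -lee_fin !cdfRE; exact: cdf_nondecreasing.
- move=> x; apply: fine_cvg; rewrite cdfRE; exact: cdf_right_continuous.
- by apply: fine_cvg; exact: cvg_cdfNy0.
- by apply: fine_cvg; exact: cvg_cdfy1.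
Qed.

Lemma distribution_quant X A : measurable A ->
  distribution P X A = distribution lam (quantRV (is_cdf_cdfR X)) A.
Proof.
apply: eq_finite_measureR.
  by apply: (@le_lt_trans _ _ 1%E); [exact: probability_le1|exact: ltry].
move=> x; rewrite -[LHS]/(cdf X x) -cdfRE.
by rewrite -(quant_law x (is_cdf_cdfR X)).
Qed.

(** Continuity from below. [D] is the whole space for the left limit of a distribution function, and
    an event on the second variable for the joint law with one strict inequality. *)
Lemma cvg_measure_lt X (D : set T) x : measurable D ->
  P ((X @^-1` `]-oo, x - k.+1%:R^-1]) `&` D) @[k --> \oo] -->
  P ((X @^-1` `]-oo, x[) `&` D).
Proof.
move=> mD; have mX B : measurable B -> measurable (X @^-1` B).
  by move=> mB; rewrite -[X in measurable X]setTI; exact: measurable_funP.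
have -> : (X @^-1` `]-oo, x[) `&` D =
    \bigcup_k ((X @^-1` `]-oo, x - k.+1%:R^-1]) `&` D).
  apply/seteqP; split => [w|w [k _]] /=; rewrite !in_itv /= => -[xw Dw]; last first.
    by split => //; rewrite (le_lt_trans xw)// gtrDl oppr_lt0 invr_gt0.
  have [k] := ltr_add_invr xw; rewrite -ltrBrDr => /ltW Xk; by exists k.
apply: nondecreasing_cvg_mu.
- by move=> k; apply: measurableI => //; exact: mX.
- by apply: bigcup_measurable => k _; apply: measurableI => //; exact: mX.
- move=> m n mn; apply/subsetPset => w /=; rewrite !in_itv /= => -[Xw Dw]; split => //.
  by rewrite (le_trans Xw)// lerB// lef_pV2 ?posrE// ler_nat.
Qed.

Lemma left_version_cdfR X x :
  (left_version (cdfR X) x)%:E = P (X @^-1` `]-oo, x[).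
Proof.
have c1 := @cvg_cdf_left_seq R _ x (is_cdf_cdfR X).
have c2 := @cvg_measure_lt X setT x measurableT.
have c3 : P ((X @^-1` `]-oo, x - k.+1%:R^-1]) `&` setT) @[k --> \oo] -->
    (left_version (cdfR X) x)%:E.
  rewrite (_ : (fun k => _) = EFin \o (fun k => cdfR X (x - k.+1%:R^-1))).
    by apply: cvg_EFin; [exact: nearW|exact: c1].
  by apply/funext => k /=; rewrite setIT cdfRE.
rewrite setIT in c2; exact: (cvg_unique (@ereal_hausdorff R) c3 c2).
Qed.

(** The copula relation concerns Y <= y, while xi needs the event Y < y. It passes to the limit
    along y - 1 / (k + 1) because [C] is 1-Lipschitz in its first argument. *)
Lemma joint_lt_copula Y X C y x : is_copula_of Y X C ->
  P ((Y @^-1` `]-oo, y[) `&` (X @^-1` `]-oo, x])) =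
  (C (left_version (cdfR Y) y) (cdfR X x))%:E.
Proof.
move=> [cC CE].
have mXx : measurable (X @^-1` `]-oo, x]).
  by rewrite -[X in measurable X]setTI; exact: measurable_funP.
have c2 := @cvg_measure_lt Y _ y mXx.
have hY := is_cdf_cdfR Y; have hX := is_cdf_cdfR X.
have c1 := @cvg_cdf_left_seq R _ y hY.
have c3 : C (cdfR Y (y - k.+1%:R^-1)) (cdfR X x) @[k --> \oo] -->
    C (left_version (cdfR Y) y) (cdfR X x).
  have := is_cdf01 x hX => x01.
  apply/cvgrPdist_lt => e e0; near=> k.
  have lk : cdfR Y (y - k.+1%:R^-1) <= left_version (cdfR Y) y.
    by apply: left_version_ge => //; rewrite gtrDl oppr_lt0 invr_gt0.
  have /andP[yk0 yk1] := is_cdf01 (y - k.+1%:R^-1) hY.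
  have /andP[l0 l1] := left_version01 y hY.
  rewrite ger0_norm ?subr_ge0 ?copula_ndl//.
  apply: le_lt_trans (copula_lipl cC x01 yk0 lk l1) _.
  rewrite -[ltLHS]ger0_norm ?subr_ge0//.
  by near: k; move/cvgrPdist_lt : c1; exact.
apply: (cvg_unique (@ereal_hausdorff R) c2).
rewrite (_ : (fun k => _) = EFin \o (fun k => C (cdfR Y (y - k.+1%:R^-1)) (cdfR X x))).
  by apply: cvg_EFin; [exact: nearW|exact: c3].
apply/funext => k /=; rewrite -CE /joint_cdfR fineK ?fin_num_measure//.
rewrite (_ : [set w | _] = (Y @^-1` `]-oo, y - k.+1%:R^-1]) `&` (X @^-1` `]-oo, x])).
  apply: measurableI => //.
  by rewrite -[X in measurable X]setTI; exact: measurable_funP.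
by apply/seteqP; split => w /=; rewrite !in_itv.
Unshelve. all: by end_near. Qed.

End cdfR_theory.

Section density_measure.
Context d (T : measurableType d) (R : realType) (P : probability T R).
Context (f : T -> R) (mf : measurable_fun setT f) (f0 : forall x, 0 <= f x).

(* The unused arguments let the measure structure be inferred from the term. *)
Definition density_measure (_ : measurable_fun setT f) (_ : forall x, 0 <= f x) :=
  fun A : set T => (\int[P]_(x in A) (f x)%:E)%E.

Local Notation nu := (density_measure mf f0).

Let nu0 : nu set0 = 0%E. Proof. by rewrite /density_measure integral_set0. Qed.

Let nu_ge0 A : (0 <= nu A)%E.
Proof. by apply: integral_ge0 => x _; rewrite lee_fin. Qed.

Let nu_sigma_additive : semi_sigma_additive nu.
Proof.
apply: semi_sigma_additive_nng_induced; first exact/measurable_EFinP.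
by move=> x; rewrite lee_fin.
Qed.

HB.instance Definition _ := isMeasure.Build _ _ _ nu nu0 nu_ge0 nu_sigma_additive.

End density_measure.

(** * Variances of functions with values in [0, 1] *)

Section variance.
Context d (T : measurableType d) (R : realType) (P : probability T R).

Lemma ae_eq_variance (g h : T -> R) : measurable_fun setT h ->
  {ae P, forall w, g w = h w} -> 'V_P[g]%E = 'V_P[h]%E.
Proof.
move=> mh gh; have Egh : 'E_P[g]%E = 'E_P[h]%E.
  rewrite unlock; apply: ae_eq_integral_nonmeasurable => //.
    exact/measurable_EFinP.
  by apply: filterS gh => w -> .
rewrite /variance unlock Egh unlock.
apply: ae_eq_integral_nonmeasurable => //.
  apply/measurable_EFinP; apply: measurable_funM; exact: measurable_funB.
apply: filterS gh => w ghw _; set c := fine _.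
by rewrite -[LHS]/(((g w - c) * (g w - c))%:E) ghw.
Qed.

Lemma variance_bounded01 (h : T -> R) : measurable_fun setT h ->
  (forall w, 0 <= h w <= 1) ->
  'V_P[h]%E = (\int[P]_w (h w * h w) - (\int[P]_w h w) ^+ 2)%:E.
Proof.
move=> mh h01; have hi := bounded01_integrable P mh h01.
have hhi : P.-integrable setT (EFin \o (h * h)).
  apply: bounded01_integrable; first exact: measurable_funM.
  move=> w; have /andP[h0 h1] := h01 w.
  by rewrite !fctE mulr_ge0//= mulr_ile1.
rewrite /variance covarianceE; try exact/Lfun1_integrable.
rewrite expr2 EFinB EFinM unlock; congr (_ - _)%E.
  by rewrite /Rintegral fineK//; exact: (integrable_fin_num measurableT hhi).
by rewrite /Rintegral fineK//; exact: (integrable_fin_num measurableT hi).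
Qed.

End variance.

(** * From the variable X to its quantile transform *)

Section conditional_probability_quant.
Context d (T : measurableType d) (R : realType) (P : probability T R).
Notation lam := (unif01 R).
Implicit Types (X Y : {RV P >-> R}).

Lemma Rintegral_quant X (f : R -> R) (B : set R) :
  measurable_fun setT f -> (forall x, `|f x| <= 1) -> measurable B ->
  \int[P]_(w in X @^-1` B) f (X w) =
  \int[lam]_(t in quant (cdfR X) @^-1` B) f (quant (cdfR X) t).
Proof.
move=> mf f1 mB; rewrite /Rintegral; congr fine.
have mEf : measurable_fun setT (EFin \o f) by exact/measurable_EFinP.
have mX : measurable_fun setT X by exact: measurable_funP.
have mq := measurable_quant (is_cdf_cdfR X).
rewrite -(@integral_pushforward _ _ _ _ _ X _ P B (EFin \o f))//; last first.
  apply: (@bounded_integrable _ _ _ P 1 _ (f \o X)) => //.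
  - by rewrite -[X in measurable X]setTI; exact: mX.
  - exact: measurableT_comp.
  - by move=> w; exact: f1.
rewrite -(@integral_pushforward _ _ _ _ _ (quant (cdfR X)) _ lam B (EFin \o f))//; last first.
  apply: (@bounded_integrable _ _ _ lam 1 _ (f \o quant (cdfR X))) => //.
  - by rewrite -[X in measurable X]setTI; exact: mq.
  - exact: measurableT_comp.
  - by move=> w; exact: f1.
by apply: eq_measure_integral => A mA _; exact: distribution_quant.
Qed.

(** In [B] both sides are finite measures on the line, so rays suffice. At ]-oo, x] both equal [C]
    at the left limit of F_Y in [y] and at F_X(x), as quant <= x means t <= F_X(x) on ]0, 1[. *)
Lemma joint_lt_integral Y X C y p : is_copula_of Y X C ->
  is_partial2 C (left_version (cdfR Y) y) p -> forall B, measurable B ->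
  P ((Y @^-1` `]-oo, y[) `&` (X @^-1` B)) =
  (\int[lam]_(t in quant (cdfR X) @^-1` B) p t)%:E.
Proof.
move=> cC [mp p01 pE dp] B mB.
have hX := is_cdf_cdfR X; have mq := measurable_quant hX.
have mqB A : measurable A -> measurable (quant (cdfR X) @^-1` A).
  by move=> mA; rewrite -[X in measurable X]setTI; exact: mq.
have mX : measurable_fun setT X by exact: measurable_funP.
have mY : measurable_fun setT Y by exact: measurable_funP.
have mD : measurable (Y @^-1` `]-oo, y[).
  by rewrite -[X in measurable X]setTI; exact: mY.
have p0 x : 0 <= p x by have /andP[] := p01 x.
pose m1_ : {measure set R -> \bar R} := pushforward (mrestr P mD) X.
pose m1 := m1_ mX.
pose m2_ : {measure set R -> \bar R} :=
  pushforward (density_measure lam mp p0) (quantRV hX).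
pose m2 := m2_ mq.
have fk A : measurable A -> (\int[lam]_(t in A) (p t)%:E)%E = (\int[lam]_(t in A) p t)%:E.
  move=> mA; rewrite /Rintegral fineK//; apply: integrable_fin_num => //.
  by apply: integrableS (bounded01_integrable lam mp p01).
rewrite setIC -fk; last exact: mqB.
apply: (@eq_finite_measureR _ m1 m2 _ _ B mB).
- apply: le_lt_trans (ltry 1).
  rewrite -[leLHS]/(P ((X @^-1` setT) `&` (Y @^-1` `]-oo, y[))).
  by rewrite preimage_setT setTI; exact: probability_le1.
- move=> x; rewrite -[LHS]/(P ((X @^-1` `]-oo, x]) `&` (Y @^-1` `]-oo, y[))).
  rewrite -[RHS]/(\int[lam]_(t in quant (cdfR X) @^-1` `]-oo, x]) (p t)%:E)%E.
  rewrite setIC (joint_lt_copula y x cC) fk; last exact: mqB.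
  rewrite pE; last exact: is_cdf01.
  congr EFin; apply: ae_eq_set_Rintegral => //; first exact: mqB.
  apply: filterS ae_unif01_in => t /[!in_itv]/= t01.
  by rewrite /= !in_itv /= quantE// ginv_le.
Qed.

End conditional_probability_quant.

(** * Rank correlation as a ratio of integrals over the uniform law *)

Section xi_formula.
Context d (T : measurableType d) (R : realType) (P : probability T R).
Notation lam := (unif01 R).
Implicit Types (X Y : {RV P >-> R}).

(** Uniqueness of conditional probabilities. The difference [h] is measurable for the sigma-algebra
    of [X], so the set where h >= 0 is a preimage under [X]; there and on its complement [h]
    integrates to 0, and [le_norm1_cond_exp] against the zero function makes its L1 norm vanish. *)
Lemma is_cond_prob_ae_eq X (A : set T) (g : T -> R) (f : R -> R) :
  measurable A -> is_cond_prob X A g -> measurable_fun setT f ->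
  P.-integrable setT (EFin \o (f \o X)) ->
  (forall B, measurable B ->
    (\int[P]_(w in X @^-1` B) f (X w))%:E = P (A `&` X @^-1` B)) ->
  {ae P, forall w, g w = f (X w)}.
Proof.
move=> mA [mg gi gB] mf fi fB.
have mX : measurable_fun setT X by exact: measurable_funP.
have mXpre (B : set R) : measurable B -> measurable (X @^-1` B).
  by move=> mB; rewrite -[_ @^-1` _]setTI; exact: mX.
pose h w := g w - f (X w).
have hi : P.-integrable setT (EFin \o h).
  exact: (integrableB measurableT gi fi).
have h0 B : measurable B -> \int[P]_(w in X @^-1` B) h w = 0.
  move=> mB; rewrite RintegralB//.
  - rewrite {1}/Rintegral gB; last by exists B => //; rewrite setTI.
    by rewrite -fB//= subrr.
  - exact: mXpre.
  - by apply: integrableS gi => //; exact: mXpre.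
  - by apply: integrableS fi => //; exact: mXpre.
have mh : @measurable_fun _ _ (g_sigma_algebra_preimageType X) R setT h.
  apply: measurable_funB => //; apply: measurableT_comp => //.
  by move=> _ B mB; exists B.
have [B mB BE] : (g_sigma_algebra_preimage X) [set w | 0 <= h w].
  rewrite (_ : [set w | _] = setT `&` h @^-1` `[0, +oo[).
    by apply: mh => //.
  by apply/seteqP; split => w /=; rewrite in_itv /= andbT // => -[].
rewrite setTI in BE.
suff H : {ae P, forall w, h w = 0}.
  by apply: filterS H => w /eqP; rewrite subr_eq0 => /eqP.
apply: Rintegral_norm_eq0 => //.
have i0 : P.-integrable setT (EFin \o (fun=> 0 : R)).
  exact: finite_measure_integrable_cst.
have z0 (D : set T) : \int[P]_(w in D) (0 : R) = 0.
  by rewrite /Rintegral integral0_eq.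
apply: (@le_trans _ _ (\int[P]_w `|(0 : R)|)).
  apply: le_norm1_cond_exp => //.
  - by rewrite -BE h0// z0.
  - rewrite -BE z0 -(h0 (~` B)) //; exact: measurableC.
by rewrite normr0 z0.
Qed.

Lemma variance_1sub (Q : probability R R) (f : R -> R) : measurable_fun setT f ->
  (forall t, 0 <= f t <= 1) ->
  \int[Q]_t ((1 - f t) * (1 - f t)) - (\int[Q]_t (1 - f t)) ^+ 2 =
  \int[Q]_t (f t * f t) - (\int[Q]_t f t) ^+ 2.
Proof.
move=> mf f01; have fi := bounded01_integrable Q mf f01.
have ffi : Q.-integrable setT (EFin \o (fun t => f t * f t)).
  apply: bounded01_integrable; first exact: measurable_funM.
  by move=> t; have /andP[f0 f1] := f01 t; rewrite mulr_ge0//= mulr_ile1.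
have oi : Q.-integrable setT (EFin \o (fun=> 1 : R)).
  exact: finite_measure_integrable_cst.
have f2i : Q.-integrable setT (EFin \o (fun t => 2 * f t)).
  exact: (integrableZl measurableT 2 fi).
have i1 : \int[Q]_t (1 : R) = 1.
  by rewrite Rintegral_cst// mul1r [fine _](congr1 fine (probability_setT Q)).
have o2i : Q.-integrable setT (EFin \o (fun t => 1 - 2 * f t)).
  exact: (integrableB measurableT oi f2i).
rewrite (@eq_Rintegral _ _ _ _ _ (fun t => (1 - 2 * f t) + f t * f t)); last first.
  by move=> t _; ring.
rewrite RintegralD// RintegralB// RintegralZl// RintegralB// i1; ring.
Qed.

Lemma variance_cond_prob Y X C y (u := left_version (cdfR Y) y) :
  is_copula_of Y X C ->
  'V_P[cond_prob X [set w | (y <= Y w)%R]]%E = (ci_product (cdfR X) C u u - u ^+ 2)%:E.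
Proof.
move=> hC; have [cC _] := hC; have hX := is_cdf_cdfR X; have hY := is_cdf_cdfR Y.
have u01 : 0 <= u <= 1 by exact: left_version01.
have [p hp] := copula_density cC u01.
have [phi hphi] := gen_partial2_density cC hX u01 hp.
have [mphi phi01 _ phiB] := hphi.
have mX : measurable_fun setT X by exact: measurable_funP.
have mY : measurable_fun setT Y by exact: measurable_funP.
have mq := measurable_quant hX.
set A := [set w | _]; set D := Y @^-1` `]-oo, y[.
have mD : measurable D by rewrite -[D]setTI; exact: mY.
have AD : A = ~` D.
  by apply/seteqP; split => w; rewrite /A /D /= in_itv /= leNgt => /negP.
have mA : measurable A by rewrite AD; exact: measurableC.
have phi1 x : `|phi x| <= 1 by have /andP[f0 f1] := phi01 x; rewrite ger0_norm.
have mphi' : measurable_fun setT (fun x => 1 - phi x) by exact: measurable_funB.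
have phi'01 x : 0 <= 1 - phi x <= 1.
  by have /andP[f0 f1] := phi01 x; apply/andP; split; lra.
have ophii : P.-integrable setT (EFin \o ((fun x => 1 - phi x) \o X)).
  apply: (@bounded_integrable _ _ _ P 1) => //.
    exact: measurableT_comp.
  by move=> w /=; have /andP[f0 f1] := phi'01 (X w); rewrite ger0_norm.
have phii : P.-integrable setT (EFin \o (phi \o X)).
  apply: (@bounded_integrable _ _ _ P 1) => //; first exact: measurableT_comp.
  by move=> w /=.
have gE : {ae P, forall w, cond_prob X A w = 1 - phi (X w)}.
  apply: (is_cond_prob_ae_eq (f := fun x => 1 - phi x) mA _ mphi' ophii).
    exact: getPex (is_cond_prob_exists X mA).
  move=> B mB; have mS : measurable (X @^-1` B).
    by rewrite -[_ @^-1` _]setTI; exact: mX.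
  rewrite RintegralB//; last 2 first.
  - exact: finite_measure_integrable_cst.
  - by apply: integrableS phii.
  rewrite Rintegral_cst// mul1r Rintegral_quant// phiB// EFinB.
  rewrite -(joint_lt_integral hC hp mB) fineK ?fin_num_measure//.
  rewrite AD [in RHS]setIC -setDE measureD//; first by rewrite [in LHS]setIC.
  by apply: le_lt_trans (ltry 1); exact: probability_le1.
have mphiX : measurable_fun setT (fun w => 1 - phi (X w)).
  exact: (measurableT_comp mphi' mX).
rewrite (ae_eq_variance mphiX gE) variance_bounded01//.
congr EFin.
(* Both moments move from [P] to [lam], where [phi] along the quantile transform represents the
   generalized derivative: its second moment is [ci_product] and its mean is [u]. *)
have := @Rintegral_quant _ _ _ _ X (fun x => (1 - phi x) * (1 - phi x)) setT.
rewrite preimage_setT => -> //; last 2 first.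
- exact: measurable_funM.
- move=> x; have /andP[f0 f1] := phi'01 x.
  by rewrite ger0_norm ?mulr_ge0// mulr_ile1.
have := @Rintegral_quant _ _ _ _ X (fun x => 1 - phi x) setT.
rewrite preimage_setT => -> //; last first.
  by move=> x; have /andP[f0 f1] := phi'01 x; rewrite ger0_norm.
apply: etrans (@variance_1sub lam (phi \o quant (cdfR X)) _ _) _ => //.
- exact: measurableT_comp.
- by move=> t; exact: phi01.
have := phiB setT measurableT; rewrite preimage_setT => ->.
rewrite (partial2_mean cC u01 hp).
have rep := gen_partial2_represents hX hphi.
by rewrite /ci_product (Rintegral01M_ae rep rep).
Qed.

Lemma variance_indic_ge Y y (u := left_version (cdfR Y) y) :
  'V_P[\1_[set w | (y <= Y w)%R]]%E = (u - u ^+ 2)%:E.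
Proof.
have mY : measurable_fun setT Y by exact: measurable_funP.
set A := [set w | _]; set D := Y @^-1` `]-oo, y[.
have mD : measurable D by rewrite -[D]setTI; exact: mY.
have AD : A = ~` D.
  by apply/seteqP; split => w; rewrite /A /D /= in_itv /= leNgt => /negP.
have mA : measurable A by rewrite AD; exact: measurableC.
have PA : P A = (1 - u)%:E.
  by rewrite AD probability_setC// -left_version_cdfR EFinB.
rewrite variance_bounded01//; last first.
  by move=> w; rewrite indicE; case: (_ \in _); rewrite ?lexx ler01.
congr EFin; rewrite (@eq_Rintegral _ _ _ _ _ (\1_A)); last first.
  by move=> w _; rewrite indicE; case: (_ \in _); rewrite ?mulr1 ?mulr0.
have -> : \int[P]_w \1_A w = 1 - u.
  by rewrite /Rintegral integral_indic// setIT [fine _](congr1 fine PA).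
ring.
Qed.

Lemma Rintegral_distribution_quant Y (k : R -> R) : measurable_fun setT k ->
  (forall x, `|k x| <= 1) ->
  \int[distribution P Y]_y k y = \int[lam]_t k (quant (cdfR Y) t).
Proof.
move=> mk k1; have mY : measurable_fun setT Y by exact: measurable_funP.
have := @Rintegral_quant _ _ _ _ Y k setT mk k1 measurableT.
rewrite !preimage_setT => <-; rewrite /Rintegral; congr fine.
rewrite integral_distribution//; first exact/measurable_EFinP.
apply: (@bounded_integrable _ _ _ P 1 _ (k \o Y)) => //.
  exact: measurableT_comp.
by move=> w; exact: k1.
Qed.

Lemma xiE Y X C (a := fun t => left_version (cdfR Y) (quant (cdfR Y) t)) :
  is_copula_of Y X C ->
  xi Y X = (\int[lam]_t (ci_product (cdfR X) C (a t) (a t) - a t ^+ 2)) /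
           (\int[lam]_t (a t - a t ^+ 2)).
Proof.
move=> hC; have [cC _] := hC; have hX := is_cdf_cdfR X; have hY := is_cdf_cdfR Y.
have mL : measurable_fun setT (left_version (cdfR Y)).
  by apply: nondecreasing_measurable => //; exact: left_version_homo.
have L01 y : 0 <= left_version (cdfR Y) y <= 1 by exact: left_version01.
rewrite /xi; congr (_ / _).
- rewrite -(@Rintegral_distribution_quant Y (fun y =>
    ci_product (cdfR X) C (left_version (cdfR Y) y) (left_version (cdfR Y) y) -
    left_version (cdfR Y) y ^+ 2)).
  + rewrite /Rintegral; congr fine; apply: eq_integral => y _.
    exact: variance_cond_prob.
  + apply: measurable_funB; last exact: measurable_funX.
    exact: measurable_ci_product_comp.
  + move=> y; have /andP[L0 L1] := L01 y.
    have /andP[c0 c1] := ci_product_diag01 hX cC (L01 y).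
    have l0 : 0 <= left_version (cdfR Y) y ^+ 2 by rewrite sqr_ge0.
    have l1 : left_version (cdfR Y) y ^+ 2 <= 1 by rewrite expr_le1.
    by rewrite ler_norml; apply/andP; split; lra.
- rewrite -(@Rintegral_distribution_quant Y (fun y =>
    left_version (cdfR Y) y - left_version (cdfR Y) y ^+ 2)).
  + rewrite /Rintegral; congr fine; apply: eq_integral => y _.
    exact: variance_indic_ge.
  + by apply: measurable_funB => //; exact: measurable_funX.
  + move=> y; have /andP[L0 L1] := L01 y.
    have l0 : 0 <= left_version (cdfR Y) y ^+ 2 by rewrite sqr_ge0.
    have l1 : left_version (cdfR Y) y ^+ 2 <= 1 by rewrite expr_le1.
    by rewrite ler_norml; apply/andP; split; lra.
Qed.

End xi_formula.

(** * The limiting denominator and the convergence of xi *)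

Section xi_convergence.
Context {R : realType}.
Notation lam := (unif01 R).

Lemma xi_denominator_gt0 d (T : measurableType d) (P : probability T R)
    (Y : {RV P >-> R}) (a := fun t => left_version (cdfR Y) (quant (cdfR Y) t)) :
  nondegenerate_rv Y -> 0 < \int[lam]_t (a t - a t ^+ 2).
Proof.
move=> ndY; have hY := is_cdf_cdfR Y; have mq := measurable_quant hY.
have a01 t : 0 <= a t <= 1 by exact: left_version01.
have ma : measurable_fun setT a.
  apply: measurableT_comp => //.
  by apply: nondecreasing_measurable => //; exact: left_version_homo.
have h01 t : 0 <= a t - a t ^+ 2 <= 1.
  have /andP[a0 a1] := a01 t; have l0 := sqr_ge0 (a t).
  by rewrite subr_ge0 expr2 ler_piMr//=; rewrite expr2 in l0; lra.
have mh : measurable_fun setT (fun t => a t - a t ^+ 2).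
  by apply: measurable_funB => //; exact: measurable_funX.
have hi := bounded01_integrable lam mh h01.
rewrite ltNge; apply/negP => int_le0; apply: ndY.
have {int_le0} a0 : {ae lam, forall t, a t = 0 /\ 0 < t < 1}.
  have h0 : {ae lam, forall t, a t - a t ^+ 2 = 0}.
    apply: Rintegral_norm_eq0 => //; apply: le_trans int_le0.
    rewrite le_eqVlt; apply/orP; left; apply/eqP; apply: eq_Rintegral => t _.
    by have /andP[h0 _] := h01 t; rewrite ger0_norm.
  (* The integrand vanishes only at a = 0 or a = 1, and a t <= t < 1 excludes the latter. *)
  apply: filterS2 h0 ae_unif01_in => t /eqP + /[!in_itv]/= t01.
  have := left_version_ginv_le hY t01; rewrite -quantE// -/(a t) => at_.
  rewrite expr2 -{1}[a t]mulr1 -mulrBr mulf_eq0 => /orP[/eqP//|/eqP a1].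
  by move: t01 => /andP[t0 t1]; exfalso; lra.
pose c := ginv (cdfR Y) (2^-1); exists c.
have half01 : 0 < (2^-1 : R) < 1 by rewrite invr_gt0 ltr0n /= invf_lt1// ltr1n.
(* For t above both s and the reference level 1 / 2 and with left limit 0, both levels lie in the
   jump ]0, b] at the quantile of t and share that quantile. The quantile function is therefore
   constant. *)
have qc s : 0 < s < 1 -> ginv (cdfR Y) s = c.
  move=> s01; have /andP[s0 s1] := s01; have /andP[i0 i1] := half01.
  have [|||t /andP[st t1] [at0 t01]] := ae_unif01_dense (x := Num.max s 2^-1) (y := 1) a0.
  - by rewrite le_max ltW.
  - by rewrite gt_max s1.
  - by [].
  move: st; rewrite gt_max => /andP[st it].
  move: at0; rewrite /a quantE// => at0.
  have tG := le_cdf_ginv hY t01.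
  rewrite /c (eq_ginv hY s01 t01) ?at0 ?(le_trans (ltW st))//.
  by rewrite (eq_ginv hY half01 t01) ?at0 ?(le_trans (ltW it)).
have mc : measurable (~` [set c]) by exact: measurableC.
exists (Y @^-1` (~` [set c])); split; last by move=> w /=.
  by rewrite -[X in measurable X]setTI; exact: measurable_funP.
apply: etrans (distribution_quant Y mc) _.
apply: etrans (measure0 lam).
rewrite -[LHS]/(lam (quant (cdfR Y) @^-1` (~` [set c]))); apply: ae_eq_measure => //.
  by rewrite -[X in measurable X]setTI; exact: mq.
apply: filterS ae_unif01_in => t /[!in_itv]/= t01.
by split => //; rewrite /= quantE// qc.
Qed.

Lemma cvg_xi_ratio (Gn Hn : nat -> R -> R) G H (Cn : nat -> R -> R -> R) C
    (an := fun n t => left_version (Hn n) (quant (Hn n) t))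
    (a := fun t => left_version H (quant H t)) :
  (forall n, is_cdf (Gn n)) -> is_cdf G -> (forall n, is_cdf (Hn n)) -> is_cdf H ->
  (forall n, is_copula (Cn n)) -> is_copula C ->
  cvg_partial2 Cn C ->
  {ae lam, forall t, Gn n (ginv (Gn n) t) @[n --> \oo] --> G (ginv G t)} ->
  {ae lam, forall t, Hn n (ginv (Hn n) t) @[n --> \oo] --> H (ginv H t)} ->
  \int[lam]_t (a t - a t ^+ 2) != 0 ->
  (\int[lam]_t (ci_product (Gn n) (Cn n) (an n t) (an n t) - an n t ^+ 2)) /
    (\int[lam]_t (an n t - an n t ^+ 2)) @[n --> \oo] -->
  (\int[lam]_t (ci_product G C (a t) (a t) - a t ^+ 2)) /
    (\int[lam]_t (a t - a t ^+ 2)).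
Proof.
move=> hGn hG hHn hH cCn cC cCnC cG cH den0.
have mL (K : R -> R) : is_cdf K ->
    measurable_fun setT (fun t => left_version K (quant K t)).
  move=> hK; apply: (measurableT_comp (f := left_version K)); last exact: measurable_quant.
  by apply: nondecreasing_measurable => //; exact: left_version_homo.
have an01 n t : 0 <= an n t <= 1 by exact: left_version01.
have a01 t : 0 <= a t <= 1 by exact: left_version01.
have ca : {ae lam, forall t, an n t @[n --> \oo] --> a t}.
  apply: filterS2 (ae_cvg_left_version_ginv hHn hH cH) ae_unif01_in => t + /[!in_itv]/= t01.
  by rewrite /a quantE//; under eq_fun do rewrite -quantE//.
have bound (c x : R) : 0 <= x <= 1 -> 0 <= c <= 1 -> `|c - x ^+ 2| <= 1.
  move=> /andP[x0 x1] /andP[c0 c1]; have l0 : 0 <= x ^+ 2 by rewrite sqr_ge0.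
  have l1 : x ^+ 2 <= 1 by rewrite expr_le1.
  by rewrite ler_norml; apply/andP; split; lra.
have ca2 t : an n t @[n --> \oo] --> a t -> an n t ^+ 2 @[n --> \oo] --> a t ^+ 2.
  by move=> c; rewrite expr2; under eq_fun do rewrite expr2; exact: cvgM.
apply: cvgM; last apply: cvgV => //.
- apply: (@cvg_Rintegral_bounded _ _ _ lam 1 _ _ _ _ _ _).2.
  + move=> n; apply: measurable_funB; last by apply: measurable_funX; exact: mL.
    by apply: measurable_ci_product_comp => //; exact: mL.
  + apply: measurable_funB; last by apply: measurable_funX; exact: mL.
    by apply: measurable_ci_product_comp => //; exact: mL.
  + by move=> n t; apply: bound => //; exact: ci_product_diag01.
  apply: filterS ca => t cat; apply: cvgB; last exact: ca2.
  apply/cvgrPdist_le => e e0; have e2 : 0 < e / 2 by rewrite divr_gt0.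
  have e4 : 0 < e / 2 / 2 by rewrite divr_gt0.
  (* The argument [an n t] moves with [n]. One half of [e] pays for replacing the n-th product by
     the limiting one, uniformly in the argument; the other for moving the argument to [a t], where
     the Lipschitz constant 2 of the diagonal accounts for the second halving in [e4]. *)
  near=> n; rewrite distrC -(subrKA (ci_product G C (an n t) (an n t))).
  apply: le_trans (ler_normD _ _) _; rewrite [leRHS]splitr lerD//.
    near: n; have := near_ci_product hGn hG cCn cC cCnC cG e2.
    by apply: filterS => n; exact.
  apply: le_trans (ci_product_diag_dist hG cC (an01 n t) (a01 t)) _.
  rewrite mulrC -ler_pdivlMr// distrC.
  by near: n; move/cvgrPdist_le : cat; exact.
- apply: (@cvg_Rintegral_bounded _ _ _ lam 1 _ _ _ _ _ _).2.
  + by move=> n; apply: measurable_funB; [|apply: measurable_funX]; exact: mL.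
  + by apply: measurable_funB; [|apply: measurable_funX]; exact: mL.
  + by move=> n t; exact: bound.
  by apply: filterS ca => t cat; apply: cvgB => //; exact: ca2.
Unshelve. all: by end_near. Qed.

Lemma closure_range_cdf (G : R -> R) : is_cdf G ->
  closure (range G) `<=` [set u | 0 <= u <= 1].
Proof.
move=> hG; have -> : [set u : R | 0 <= u <= 1] = `[0, 1]%classic.
  by apply/seteqP; split => u /=; rewrite in_itv.
rewrite [X in _ `<=` X](closure_id _).1; last exact: interval_closed.
by apply: closure_subset => _ [x _ <-] /=; rewrite in_itv /= is_cdf01.
Qed.

End xi_convergence.

Theorem theorem3p5 (R : realType)
    (dn : nat -> measure_display) (Tn : forall n, measurableType (dn n))
    (Pn : forall n, probability (Tn n) R)
    (Yn Xn : forall n, {RV (Pn n) >-> R})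
    (d : measure_display) (T : measurableType d) (P : probability T R)
    (Y X : {RV P >-> R})
    (Cn : nat -> R -> R -> R) (C : R -> R -> R)
    (ndYn : forall n, nondegenerate_rv (Yn n)) (ndY : nondegenerate_rv Y)
    (copn : forall n, is_copula_of (Yn n) (Xn n) (Cn n))
    (cop : is_copula_of Y X C)
    (Hi : cvg_partial2 Cn C)
    (Hii : {ae (@lebesgue_measure R), forall t : R, t \in `]0, 1[ ->
       cdfR (Xn n) (ginv (cdfR (Xn n)) t) @[n --> \oo]
         --> cdfR X (ginv (cdfR X) t)}) :
  {uniform closure (range (cdfR Y)) `*` closure (range (cdfR Y)),
    (fun n (p : R * R) => ci_product (cdfR (Xn n)) (Cn n) p.1 p.2) @ \oo
      --> (fun p : R * R => ci_product (cdfR X) C p.1 p.2)} /\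
  ({ae (@lebesgue_measure R), forall t : R, t \in `]0, 1[ ->
       cdfR (Yn n) (ginv (cdfR (Yn n)) t) @[n --> \oo]
         --> cdfR Y (ginv (cdfR Y) t)} ->
   xi (Yn n) (Xn n) @[n --> \oo] --> xi Y X).
Proof.
have hX := is_cdf_cdfR X; have hY := is_cdf_cdfR Y.
have hXn n := is_cdf_cdfR (Xn n); have hYn n := is_cdf_cdfR (Yn n).
have cC : is_copula C by have [] := cop.
have cCn n : is_copula (Cn n) by have [] := copn n.
have cX := ae_lebesgue_unif01 Hii; split.
  move=> B /uniform_nbhs[E [+ EB]]; rewrite -entourage_ballE => -[e /= e0 eE].
  (* [near_ci_product] yields a non-strict bound, while the ball of radius [e] asks for a strict
     one. *)
  have e2 : 0 < e / 2 by rewrite divr_gt0.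
  apply: filterS (near_ci_product hXn hX cCn cC Hi cX e2) => n ci_n.
  apply: EB => -[u v] /= [/(closure_range_cdf hY) u01 /(closure_range_cdf hY) v01].
  apply: eE; rewrite /= /ball/= distrC.
  apply: le_lt_trans (ci_n u v u01 v01) _; by rewrite ltr_pdivrMr// ltr_pMr// ltr1n.
move=> /ae_lebesgue_unif01 cY.
rewrite (xiE cop); under eq_fun do rewrite (xiE (copn _)).
by apply: cvg_xi_ratio => //; rewrite gt_eqF// xi_denominator_gt0.
Qed.
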